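(* Suppose we observe $N$ pairs $\{(y_t,X_t)\}_{t=1}^N$ satisfying $y_t=\langle X_t,M\rangle+\xi_t$, where the $X_t$ are i.i.d. uniformly sampled from $\mathcal{X}$ and the $\xi_t$ are i.i.d. $N(0,\sigma^2)$, independent of the $X_t$. Assume the true matrix $M\in\mathbb{R}^{n\times p}$ is $\mathcal{F}$-embeddable, where $\mathcal{F}$ satisfies the approximation condition of the context, with minimal cardinalities $J^*(\epsilon)$. Suppose further that $N\ge (n\wedge p)\log^2(n+p)$. Then there exists a constant $C_2>0$, depending only on $\sigma$ and $\|M\|_\infty$, such that if the regularization parameter is $$\lambda=C_2\sqrt{\frac{\log(n+p)}{N(n\wedge p)}},$$ then, with probability at least $1-2(n+p)^{-1}$, the estimator $\widehat M$ satisfies $$\frac{1}{np}\|\widehat M-M\|_F^2\le C_2^2\left(\frac{1+\sqrt2}{2}\right)^2\frac{(n\vee p)\log(n+p)}{N}\,J^*(\epsilon)+\epsilon^2$$ for any $\epsilon>0$.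
   Context: $n,p,N$ are positive integers; $a\wedge b=\min(a,b)$, $a\vee b=\max(a,b)$. For matrices, $\langle A,B\rangle=\operatorname{tr}(A^TB)$, $\|A\|_F$ is the Frobenius norm, $\|A\|_\infty=\max_{i,j}|a_{ij}|$, and $\|A\|_*$ is the nuclear norm (sum of singular values). $\mathcal{X}=\{e_n(i)e_p(j)^T: 1\le i\le n,\ 1\le j\le p\}$, where $e_n(i)\in\mathbb{R}^n$ is the $i$-th standard basis vector; uniform sampling means each element has probability $1/(np)$. Estimator: $\widehat M$ is the minimizer over $A\in\mathbb{R}^{n\times p}$ of $\frac{1}{np}\|A\|_F^2-\left\langle\frac{2}{N}\sum_{t=1}^N y_tX_t,A\right\rangle+\lambda\|A\|_*$. Equivalently, with $R=\frac{np}{N}\sum_{t=1}^N y_tX_t=\sum_j\Lambda_j u_jv_j^T$ (singular value decomposition), $\widehat M=\sum_j(\Lambda_j-\lambda np/2)_+u_jv_j^T$. Embeddability: let $K$ be a positive integer and $\mathcal{F}\subset\mathcal{L}^2(\mathbb{R}^K)$ a class of functions $\mathbb{R}^K\to\mathbb{R}$. $M\in\mathbb{R}^{n\times p}$ is $\mathcal{F}$-embeddable if there exist $f_1,\dots,f_p\in\mathcal{F}$ and $\Theta\in\mathbb{R}^{n\times K}$ with rows $\theta_{i,\cdot}$ such that $m_{ij}=f_j(\theta_{i,\cdot})$ for all $i,j$. Approximation condition on $\mathcal{F}$: there is a fixed number $C_0>0$ such that for every $\epsilon>0$ there is a finite set $\{\psi_1,\dots,\psi_J\}\subset\mathcal{F}$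 with $\|\psi_l\|_\infty\le C_0$ for all $l$ and $\max_{f\in\mathcal{F}}\min_{\|\beta\|_2^2\le C_0}\|f-\sum_{l=1}^J\beta_l\psi_l\|_\infty\le\epsilon$ (function norms are sup-norms). $J^*(\epsilon)$ denotes the minimal cardinality of such a set. *)

(* Defs.v *)
From HB Require Import structures.
From mathcomp Require Import all_boot all_order all_algebra.
From mathcomp Require Import all_classical all_reals all_analysis.
From mathcomp Require Import polyrcf.
Set Implicit Arguments.
Unset Strict Implicit.
Unset Printing Implicit Defensive.
Import Order.TTheory GRing.Theory Num.Theory.
Import numFieldNormedType.Exports.
Local Open Scope classical_set_scope.
Local Open Scope ring_scope.

Definition mxinner (R : realType) (n p : nat) (A B : 'M[R]_(n, p)) : R :=
  \tr (A^T *m B).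

Definition frobenius_norm (R : realType) (n p : nat) (A : 'M[R]_(n, p)) : R :=
  Num.sqrt (mxinner A A).

(** [rootsR] lists roots without repetition, hence the [nseq].  There are [p]
    values in total: when [n < p], at least [p - n] of them are zeros, which do
    not contribute to the nuclear norm. *)
Definition singular_values (R : realType) (n p : nat) (A : 'M[R]_(n, p)) :
    seq R :=
  let chi := char_poly (A^T *m A) in
  flatten [seq nseq (mup x chi) (Num.sqrt x) | x <- rootsR chi].

Definition nuclear_norm (R : realType) (n p : nat) (A : 'M[R]_(n, p)) : R :=
  \sum_(s <- singular_values A) s.

Definition sampling_matrices (R : realType) (n p : nat) : set 'M[R]_(n, p) :=
  [set A | exists i j,
     A = (delta_mx i 0 : 'cV[R]_n) *m (delta_mx j 0 : 'cV[R]_p)^T].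

Definition objective (R : realType) (n p N : nat) (lambda : R)
    (y : 'I_N -> R) (X : 'I_N -> 'M[R]_(n, p)) (A : 'M[R]_(n, p)) : R :=
  (n * p)%:R^-1 * frobenius_norm A ^+ 2
  - mxinner ((2 / N%:R) *: \sum_t y t *: X t) A
  + lambda * nuclear_norm A.

Definition is_estimator (R : realType) (n p N : nat) (lambda : R)
    (y : 'I_N -> R) (X : 'I_N -> 'M[R]_(n, p)) (Mhat : 'M[R]_(n, p)) : Prop :=
  forall A, objective lambda y X Mhat <= objective lambda y X A.

Notation borel_mx R n p := (g_sigma_algebraType (@open 'M[R]_(n, p))).

Definition mutually_independent d d' (Omega : measurableType d)
    (T : measurableType d') (R : realType) (P : probability Omega R) (N : nat)
    (Z : 'I_N -> {RV P >-> T}) : Prop :=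
  forall (S : {set 'I_N}) (B : 'I_N -> set T),
    (forall t, measurable (B t)) ->
    P (\bigcap_(t in [set t | t \in S]) Z t @^-1` B t) =
    (\prod_(t in S) P (Z t @^-1` B t))%E.

Definition independent_families d d1 d2 (Omega : measurableType d)
    (T1 : measurableType d1) (T2 : measurableType d2) (R : realType)
    (P : probability Omega R) (N1 N2 : nat)
    (Z1 : 'I_N1 -> {RV P >-> T1}) (Z2 : 'I_N2 -> {RV P >-> T2}) : Prop :=
  forall A B : set Omega,
    g_sigma_preimage (fun t => Z1 t : Omega -> T1) A ->
    g_sigma_preimage (fun t => Z2 t : Omega -> T2) B ->
    P (A `&` B) = (P A * P B)%E.

Section lebesgue_measure_rV.
Context (R : realType) (K : nat).
Local Open Scope ereal_scope.

Definition box (a b : 'rV[R]_K) : set 'rV[R]_K :=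
  [set x | forall i, (a 0 i < x 0 i <= b 0 i)%R].

(** The volume of a box, [0] on the empty set, and [+oo] on any set that is
    neither empty nor a box.  The library's [mu_ext] below takes the infimum
    over all countable covers; with this set function only the covers by boxes
    (and empty sets) matter, which gives the Lebesgue outer measure. *)
Definition box_volume (B : set 'rV[R]_K) : \bar R :=
  ereal_inf [set v | (B = set0 /\ v = 0) \/
    exists a b : 'rV[R]_K, [/\ forall i, (a 0 i <= b 0 i)%R, B = box a b &
      v = (\prod_i (b 0 i - a 0 i)%R)%:E]].

Local Notation T := (g_sigma_algebraType (@discrete_measurable 'rV[R]_K)).

Definition lebesgue_outer_rV : set 'rV[R]_K -> \bar R :=
  mu_ext (box_volume : set T -> \bar R).

Let box_volume_ge0 (B : set 'rV[R]_K) : 0 <= box_volume B.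
Proof.
apply: le_ereal_inf_tmp => v [[_ ->]//|[a [b [ab _ ->]]]].
by rewrite lee_fin prodr_ge0// => i _; rewrite subr_ge0.
Qed.

Let box_volume0 : box_volume set0 = 0.
Proof.
apply/eqP; rewrite eq_le box_volume_ge0 andbT.
by apply: ereal_inf_lbound; left.
Qed.

Let outer0 : lebesgue_outer_rV set0 = 0.
Proof. exact: (@mu_ext0 _ T R box_volume box_volume0 box_volume_ge0). Qed.

Let outer_ge0 A : 0 <= lebesgue_outer_rV A.
Proof. exact: (@mu_ext_ge0 _ T R box_volume box_volume_ge0). Qed.

Let le_outer : {homo lebesgue_outer_rV : A B / A `<=` B >-> A <= B}.
Proof. exact: (@le_mu_ext _ T R box_volume). Qed.

Let outer_sigma_subadditive : sigma_subadditive lebesgue_outer_rV.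
Proof. exact: (@mu_ext_sigma_subadditive _ T R box_volume box_volume_ge0). Qed.

HB.instance Definition _ := isOuterMeasure.Build R 'rV[R]_K lebesgue_outer_rV
  outer0 outer_ge0 le_outer outer_sigma_subadditive.

Definition caratheodory_measure (U : pointedType)
    (mu : {outer_measure set U -> \bar R}) :
    {measure set (caratheodory_type mu) -> \bar R} :=
  (mu : set (caratheodory_type mu) -> \bar R).

Definition L2_rV : set ('rV[R]_K -> R) :=
  [set f | f \in Lfun (caratheodory_measure lebesgue_outer_rV) 2%:E].

End lebesgue_measure_rV.

Definition embeddable (R : realType) (n p K : nat) (F : set ('rV[R]_K -> R))
    (M : 'M[R]_(n, p)) : Prop :=
  exists (f : 'I_p -> 'rV[R]_K -> R) (Theta : 'M[R]_(n, K)),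
    (forall j, F (f j)) /\ (forall i j, M i j = f j (row i Theta)).

Definition sup_norm (R : realType) (T : Type) (f : T -> R) : \bar R :=
  ereal_sup [set `|f x|%:E | x in setT].

Definition approximation_error (R : realType) (K J : nat) (C0 : R)
    (psi : 'I_J -> 'rV[R]_K -> R) (f : 'rV[R]_K -> R) : \bar R :=
  ereal_inf [set sup_norm (fun x => f x - \sum_l beta 0 l * psi l x)
    | beta in [set beta : 'rV[R]_J | \sum_l beta 0 l ^+ 2 <= C0]].

(** [psi] is required to be injective because it enumerates a set: repeating a
    function would relax the constraint on the coefficients. *)
Definition approximable (R : realType) (K : nat) (F : set ('rV[R]_K -> R))
    (C0 eps : R) (J : nat) : Prop :=
  exists psi : 'I_J -> 'rV[R]_K -> R,
    [/\ injective psi,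
        forall l, F (psi l),
        forall l, (sup_norm (psi l) <= C0%:E)%E &
        (ereal_sup [set approximation_error C0 psi f | f in F] <= eps%:E)%E].

Definition approximation_condition (R : realType) (K : nat)
    (F : set ('rV[R]_K -> R)) (C0 : R) : Prop :=
  0 < C0 /\ forall eps, 0 < eps -> exists J, approximable F C0 eps J.

(** The least [J] such that [approximable F C0 eps J]; the default [0] is only
    used when there is none. *)
Definition Jstar (R : realType) (K : nat) (F : set ('rV[R]_K -> R))
    (C0 eps : R) : nat :=
  xget 0%N [set J | approximable F C0 eps J /\
                    forall J', approximable F C0 eps J' -> (J <= J')%N].

Lemma JstarP (R : realType) (K : nat) (F : set ('rV[R]_K -> R)) (C0 eps : R) :
  approximation_condition F C0 -> 0 < eps ->
  approximable F C0 eps (Jstar F C0 eps) /\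
  forall J, approximable F C0 eps J -> (Jstar F C0 eps <= J)%N.
Proof.
move=> [_ /[apply]] exJ; rewrite /Jstar.
case: xgetP => [J _ //|noJ]; exfalso.
have exb : exists J, `[< approximable F C0 eps J >].
  by have [J aJ] := exJ; exists J; apply/asboolP.
have [J /asboolP aJ Jmin] := ex_minnP exb.
by apply: (noJ J); split=> // J' /asboolP /Jmin.
Qed.

(* Main.v *)
Require Import Defs.
From mathcomp Require Import all_boot all_order all_algebra.
From mathcomp Require Import all_classical all_reals all_analysis.
From mathcomp Require Import measurable_realfun polyrcf complex ring lra.
Set Implicit Arguments.
Unset Strict Implicit.
Unset Printing Implicit Defensive.
Import Order.TTheory GRing.Theory Num.Theory.
Import numFieldNormedType.Exports.
Local Open Scope classical_set_scope.
Local Open Scope ring_scope.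

(** Up to a factor and an additive constant, the estimator minimizes
    [|A - Y|^2 + mu |A|_*], where [Y = (n p / N) sum_t y_t X_t] is an unbiased
    estimator of [M] and [mu = lambda n p].  The theorem combines a deterministic
    and a probabilistic fact.

    The deterministic fact, [nuclear_oracle], is that as soon as the operator
    norm of [Y - M] is at most [mu / 2], every matrix [A] of rank [r] satisfies
    [|Mhat - M|^2 <= |A - M|^2 + ((1 + sqrt 2) / 2)^2 mu^2 r].  It rests on the
    duality between the nuclear and the operator norm ([nuclear_dual],
    [nuclear_dual_attained]), which comes from the spectral theorem for
    [A^T A].  An embeddable [M] is entrywise within about [eps] of a matrix of
    rank at most [J^*(eps)] ([low_rank_approximation]), which is the [A] to use.

    The probabilistic fact is that the operator norm of [Y - M] is small.  There
    are two contributions, the fluctuation of the sampled cells of [M] and the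
    Gaussian noise.  In both cases the operator norm is bounded by the trace of a
    power [2k] of the symmetric dilation ([dilation_opbounded]), with [k] close
    to [log (n + p)], so that the dimension costs only a constant factor.  The
    expected trace is bounded by the method of exchangeable pairs
    ([matrix_moment]) in terms of a conditional variance.  Since a sampled matrix
    has a single nonzero entry, this variance is diagonal: it counts, or weighs,
    the visits of each row and of each column, and the usual scalar estimates for
    binomial variables apply.
    - For the cells of [M], the probability space is the finite set of samples
      with the uniform measure ([sampling_moment]).
    - For the noise, the law of [(xi_1, ..., xi_N)] does not change when signs
      are flipped ([sign_flip]), so one can average over independent random signs
      while the squares [xi_t^2] stay fixed ([rademacher_moment],
      [noise_tail]).  The total squared noise in each row and column is bounded
      by a Chernoff argument ([weights_tail]).

    Each of the three bad events has probability at most [(n + p)^-2]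
    ([failure_prob_le]). *)

(** * Inner product of matrices *)

Section inner.
Context {R : realType}.
Implicit Types (m n p : nat).

Lemma mxinnerE m n (A B : 'M[R]_(m, n)) :
  mxinner A B = \sum_i \sum_j A i j * B i j.
Proof.
rewrite /mxinner /mxtrace exchange_big/=; apply: eq_bigr => j _.
by rewrite mxE; apply: eq_bigr => i _; rewrite mxE.
Qed.

Lemma mxinnerC m n (A B : 'M[R]_(m, n)) : mxinner A B = mxinner B A.
Proof.
by rewrite !mxinnerE; apply: eq_bigr => i _; apply: eq_bigr => j _; rewrite mulrC.
Qed.

Lemma mxinnerDl m n (A B C : 'M[R]_(m, n)) :
  mxinner (A + B) C = mxinner A C + mxinner B C.
Proof. by rewrite /mxinner linearD/= mulmxDl mxtraceD. Qed.

Lemma mxinnerDr m n (A B C : 'M[R]_(m, n)) :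
  mxinner A (B + C) = mxinner A B + mxinner A C.
Proof. by rewrite /mxinner mulmxDr mxtraceD. Qed.

Lemma mxinnerZl m n a (A B : 'M[R]_(m, n)) : mxinner (a *: A) B = a * mxinner A B.
Proof. by rewrite /mxinner linearZ/= -scalemxAl mxtraceZ. Qed.

Lemma mxinnerZr m n a (A B : 'M[R]_(m, n)) : mxinner A (a *: B) = a * mxinner A B.
Proof. by rewrite mxinnerC mxinnerZl mxinnerC. Qed.

Lemma mxinnerNl m n (A B : 'M[R]_(m, n)) : mxinner (- A) B = - mxinner A B.
Proof. by rewrite -scaleN1r mxinnerZl mulN1r. Qed.

Lemma mxinnerNr m n (A B : 'M[R]_(m, n)) : mxinner A (- B) = - mxinner A B.
Proof. by rewrite mxinnerC mxinnerNl mxinnerC. Qed.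

Definition mxinnerL := (@mxinnerDl, @mxinnerDr, @mxinnerNl, @mxinnerNr,
  @mxinnerZl, @mxinnerZr).

Lemma mxinner_ge0 m n (A : 'M[R]_(m, n)) : 0 <= mxinner A A.
Proof.
by rewrite mxinnerE; do 2![apply: sumr_ge0 => ? _]; rewrite -expr2 sqr_ge0.
Qed.

Lemma mxinner_eq0 m n (A : 'M[R]_(m, n)) : mxinner A A = 0 -> A = 0.
Proof.
rewrite mxinnerE => A0; apply/matrixP => i j; rewrite mxE.
have H k l : 0 <= A k l * A k l by rewrite -expr2 sqr_ge0.
move/eqP: A0; rewrite psumr_eq0 => [|k _]; last exact: sumr_ge0.
move/allP => /(_ i (mem_index_enum _)) /=; rewrite psumr_eq0//.
by move=> /allP /(_ j (mem_index_enum _)) /=; rewrite mulf_eq0 orbb => /eqP.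
Qed.

Lemma frobenius_normE m n (A : 'M[R]_(m, n)) : frobenius_norm A ^+ 2 = mxinner A A.
Proof. by rewrite sqr_sqrtr// mxinner_ge0. Qed.

Lemma mxinner_mull m n p (B : 'M[R]_(m, n)) (A : 'M[R]_(n, p)) C :
  mxinner (B *m A) C = mxinner A (B^T *m C).
Proof. by rewrite /mxinner trmx_mul mulmxA. Qed.

Lemma mxinner_mulr m n p (A : 'M[R]_(m, n)) (B : 'M[R]_(n, p)) C :
  mxinner (A *m B) C = mxinner A (C *m B^T).
Proof. by rewrite /mxinner trmx_mul -mulmxA mxtrace_mulC mulmxA. Qed.

Lemma mxinner_tr m n (A B : 'M[R]_(m, n)) : mxinner A^T B^T = mxinner A B.
Proof. by rewrite /mxinner trmxK mxtrace_mulC; exact: mxinnerC. Qed.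

Lemma mxinner_CS m n (A B : 'M[R]_(m, n)) :
  mxinner A B ^+ 2 <= mxinner A A * mxinner B B.
Proof.
have [/eqP/mxinner_eq0 ->|A0] := boolP (mxinner A A == 0).
  by rewrite /mxinner trmx0 !mul0mx mxtrace0 expr0n mul0r.
have A_gt0 : 0 < mxinner A A by rewrite lt_neqAle eq_sym A0 mxinner_ge0.
have := mxinner_ge0 (mxinner A A *: B - mxinner A B *: A).
rewrite !mxinnerL (mxinnerC B A) => H.
by rewrite -(ler_pM2l A_gt0) -subr_ge0; lra.
Qed.

Lemma mxinner_le m n (A B : 'M[R]_(m, n)) :
  mxinner A B <= Num.sqrt (mxinner A A) * Num.sqrt (mxinner B B).
Proof.
rewrite -sqrtrM ?mxinner_ge0// (le_trans (ler_norm _))//.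
by rewrite -sqrtr_sqr ler_wsqrtr// mxinner_CS.
Qed.

Lemma mxinner_rows m n (A B : 'M[R]_(m, n)) :
  mxinner A B = \sum_i mxinner (row i A) (row i B).
Proof.
rewrite mxinnerE; apply: eq_bigr => i _; rewrite mxinnerE big_ord1.
by apply: eq_bigr => j _; rewrite !mxE.
Qed.

Lemma mxinner_row n (x y : 'rV[R]_n) : mxinner x y = (x *m y^T) 0 0.
Proof. by rewrite mxinnerC /mxinner mxtrace_mulC /mxtrace big_ord1. Qed.

End inner.

(** * Spectral theorem for real symmetric matrices *)

Section spectral.
Context {R : realType}.

(** Seen as a complex matrix, [A] is Hermitian, so it has a real eigenvalue;
    this is a root of the characteristic polynomial of [A] itself. *)
Lemma symmetric_eigenvalue n (A : 'M[R]_n.+1) : A^T = A ->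
  exists a, eigenvalue A a.
Proof.
move=> sA; pose Ac := map_mx (real_complex R) A.
have Ac_real : Ac \is a mxOver Num.real.
  by apply/mxOverP => i j; rewrite mxE complex_real.
have Ac_sym : Ac \is symmetricmx.
  by apply/is_hermitianmxP; rewrite expr0 scale1r map_mx_id// /Ac map_trmx sA.
have Ac_herm := realsym_hermsym Ac_sym Ac_real.
have := hermitian_spectral_diag_real Ac_herm => /mxOverP /(_ 0 0).
have /hermitian_normalmx /orthomx_spectralP := Ac_herm.
set P := spectralmx _; set D := spectral_diag _ => AE a_real.
have Pu : P \in unitmx := spectral_unit _.
have : eigenvalue Ac (D 0 0).
  apply/eigenvalueP; exists (row 0 P).
    rewrite -row_mul {1}AE !mulmxA mulmxV// mul1mx; apply/rowP => j.
    by rewrite mul_diag_mx !mxE.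
  apply/eqP => P0; have := mulmxV Pu => /matrixP /(_ 0 0).
  rewrite mxE big1 => [|j _]; last first.
    by have /rowP /(_ j) := P0; rewrite !mxE => ->; rewrite mul0r.
  by rewrite mxE eqxx => /eqP; rewrite eq_sym oner_eq0.
rewrite eigenvalue_root_char -map_char_poly.
have -> : D 0 0 = real_complex R (complex.Re (D 0 0)) by rewrite RRe_real.
rewrite fmorph_root -eigenvalue_root_char => eA.
by exists (complex.Re (D 0 0)).
Qed.

(** The reflection that exchanges [v] with the first basis vector. *)
Lemma householder n (v : 'rV[R]_n.+1) : mxinner v v = 1 ->
  exists H : 'M[R]_n.+1, H *m H^T = 1%:M /\ row 0 H = v.
Proof.
move=> v1; pose e : 'rV[R]_n.+1 := delta_mx 0 0.
have e1 : mxinner e e = 1.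
  by rewrite mxinner_row trmx_delta mul_delta_mx mxE eqxx.
pose w := v - e; pose q := mxinner w w.
have [q0|q0] := eqVneq q 0.
  exists 1%:M; rewrite trmx1 mulmx1; split=> //.
  by rewrite row1; apply/esym/eqP; rewrite -subr_eq0; apply/eqP/mxinner_eq0.
have qE : q = 2 - 2 * mxinner e v.
  by rewrite /q /w !mxinnerL v1 e1 (mxinnerC v e); ring.
have wwE : w *m w^T = q%:M by rewrite [LHS]mx11_scalar -mxinner_row.
pose H : 'M[R]_n.+1 := 1%:M - (2 / q) *: (w^T *m w).
have HT : H^T = H by rewrite linearB/= linearZ/= trmx1 trmx_mul trmxK.
exists H; rewrite HT; split.
  rewrite mulmxBl mul1mx mulmxBr mulmx1 -!scalemxAl -!scalemxAr.
  rewrite -[w^T *m w *m _]mulmxA (mulmxA w w^T) wwE mul_scalar_mx -scalemxAr.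
  rewrite !scalerA -addrA -opprD -scalerBl -scalerDl.
  by rewrite [X in _ - X *: _](_ : _ = 0) ?scale0r ?subr0//; field.
rewrite rowE mulmxBr mulmx1 -scalemxAr mulmxA.
have -> : e *m w^T = (- (q / 2))%:M.
  rewrite [LHS]mx11_scalar -mxinner_row /w !mxinnerL e1 qE; congr (_%:M).
  by field.
rewrite mul_scalar_mx scalerA (_ : _ * _ = -1); last by field.
by rewrite scaleN1r opprK /w addrC subrK.
Qed.

Let block_spectral n a (C U : 'M[R]_n) d : U *m U^T = 1%:M ->
  C = U^T *m diag_mx d *m U ->
  exists V : 'M[R]_(1 + n), V *m V^T = 1%:M /\
    block_mx a%:M 0 0 C = V^T *m (diag_mx (row_mx a%:M d) *m V).
Proof.
move=> UU CE; exists (block_mx 1%:M 0 0 U).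
rewrite tr_block_mx diag_mx_row !mulmx_block !trmx0 trmx1.
rewrite !(mulmx0, mul0mx, addr0, add0r, mulmx1, mul1mx) UU.
rewrite -scalar_mx_block; split=> //; rewrite CE mulmxA; congr block_mx.
by apply/matrixP => i j; rewrite !mxE !ord1 !eqxx.
Qed.

(** Deflation: after a reflection carrying a unit eigenvector to the first
    basis vector, a symmetric matrix is block diagonal. *)
Theorem symmetric_spectral n (A : 'M[R]_n) : A^T = A ->
  exists (U : 'M[R]_n) (d : 'rV[R]_n),
    U *m U^T = 1%:M /\ A = U^T *m diag_mx d *m U.
Proof.
elim: n A => [|n IHn] A sA.
  by exists 1%:M, 0; split; apply/matrixP => -[].
have [a /eigenvalueP[v vA v0]] := symmetric_eigenvalue sA.
have vv_gt0 : 0 < mxinner v v.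
  rewrite lt_neqAle mxinner_ge0 andbT eq_sym; apply: contra_neq v0.
  exact: mxinner_eq0.
pose c := (Num.sqrt (mxinner v v))^-1.
have [|H [HH H0]] := @householder n (c *: v).
  rewrite !mxinnerL mulrA -expr2 exprVn sqr_sqrtr ?mxinner_ge0//.
  by rewrite mulVf// gt_eqF.
have HTH : H^T *m H = 1%:M by apply: mulmx1C.
pose B : 'M[R]_(1 + n) := H *m A *m H^T.
have sB : B^T = B by rewrite /B !trmx_mul trmxK sA mulmxA.
have B0 : row 0 B = a *: delta_mx 0 0.
  have HvT : c *: v *m H^T = delta_mx 0 0 by rewrite -H0 -row_mul HH row1.
  by rewrite /B !row_mul H0 -scalemxAl vA scalerA mulrC -scalerA -scalemxAl HvT.
have Bur : ursubmx B = 0.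
  apply/matrixP => i j; rewrite !mxE ord1.
  have /rowP /(_ (rshift 1 j)) := B0; rewrite !mxE => BE.
  by rewrite (_ : lshift n 0 = 0) ?BE ?mulr0//; apply/val_inj.
have Bul : ulsubmx B = a%:M.
  apply/matrixP => i j; rewrite !mxE !ord1.
  have /rowP /(_ 0) := B0; rewrite !mxE => BE.
  by rewrite (_ : lshift n 0 = 0) ?BE ?mulr1//; apply/val_inj.
have Bdl : dlsubmx B = 0 by rewrite -[B]sB -trmx_ursub Bur trmx0.
have [|U' [d' [UU' BE']]] := IHn (drsubmx B); first by rewrite trmx_drsub sB.
have BE : B = block_mx a%:M 0 0 (drsubmx B).
  by rewrite -[LHS]submxK Bur Bul Bdl.
have [U0 [UU0 BE0]] := block_spectral a UU' BE'.
exists (U0 *m H), (row_mx a%:M d'); split.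
  by rewrite trmx_mul mulmxA -[_ *m H *m _]mulmxA HH mulmx1.
have -> : (U0 *m H)^T *m diag_mx (row_mx a%:M d') *m (U0 *m H) = H^T *m B *m H.
  by rewrite BE BE0 trmx_mul !mulmxA.
by rewrite /B !mulmxA HTH mul1mx -mulmxA HTH mulmx1.
Qed.

End spectral.

(** * Operator bounds and the nuclear norm *)

Section nuclear.
Context {R : realType}.

Lemma char_poly_orthogonal n (U : 'M[R]_n) (d : 'rV[R]_n) : U *m U^T = 1%:M ->
  char_poly (U^T *m diag_mx d *m U) = \prod_i ('X - (d 0 i)%:P).
Proof.
move=> /mulmx1C UU; pose V := map_mx (@polyC R) U.
pose W := map_mx (@polyC R) U^T.
have WV : W *m V = 1%:M by rewrite -map_mxM UU map_mx1.
have -> : char_poly (U^T *m diag_mx d *m U) = char_poly (diag_mx d).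
  rewrite /char_poly.
  have -> : char_poly_mx (U^T *m diag_mx d *m U)
      = W *m char_poly_mx (diag_mx d) *m V.
    rewrite /char_poly_mx mulmxBr mulmxBl !map_mxM; congr (_ - _).
    by rewrite scalar_mxC -mulmxA WV mulmx1.
  by rewrite !det_mulmx mulrAC -det_mulmx WV det1 mul1r.
rewrite char_poly_trig ?diag_mx_is_trig//; apply: eq_bigr => i _.
by rewrite mxE eqxx.
Qed.

Lemma nuclear_normE n p (A : 'M[R]_(n, p)) (U : 'M[R]_p) (d : 'rV[R]_p) :
  U *m U^T = 1%:M -> A^T *m A = U^T *m diag_mx d *m U ->
  nuclear_norm A = \sum_i Num.sqrt (d 0 i).
Proof.
move=> UU AE; rewrite /nuclear_norm /singular_values AE char_poly_orthogonal//.
pose s := [seq d 0 i | i <- index_enum 'I_p].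
have -> : \prod_i ('X - (d 0 i)%:P) = \prod_(x <- s) ('X - x%:P).
  by rewrite big_map.
set chi := \prod_(x <- s) _.
have chi0 : chi != 0 by rewrite monic_neq0// monic_prod_XsubC.
have prm : perm_eq (rootsR chi) (undup s).
  apply: uniq_perm; [exact: uniq_roots|exact: undup_uniq|move=> x].
  by rewrite -roots_on_rootsR// mem_undup /= rootE -rootE root_prod_XsubC.
rewrite big_flatten big_map (perm_big _ prm)/=.
under eq_bigr => x _ do rewrite big_nseq mu_prod_XsubC -Monoid.iteropE.
rewrite -(big_map (fun i => d 0 i) xpredT Num.sqrt) -/s.
exact: big_undup_iterop_count.
Qed.

(** For [0 <= c] this bounds the operator norm, the largest singular value, by [c]. *)
Definition opbounded n p (c : R) (A : 'M[R]_(n, p)) :=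
  forall x : 'rV[R]_n, mxinner (x *m A) (x *m A) <= c ^+ 2 * mxinner x x.

Lemma opbounded_mul m n p c (A : 'M[R]_(n, p)) (B : 'M[R]_(m, n)) :
  opbounded c A -> mxinner (B *m A) (B *m A) <= c ^+ 2 * mxinner B B.
Proof.
move=> cA; rewrite mxinner_rows (mxinner_rows B) mulr_sumr.
by apply: ler_sum => i _; rewrite row_mul.
Qed.

Lemma opboundedW n p c (A : 'M[R]_(n, p)) : 0 <= c -> opbounded c A ->
  forall x : 'rV[R]_n,
  Num.sqrt (mxinner (x *m A) (x *m A)) <= c * Num.sqrt (mxinner x x).
Proof.
move=> c0 cA x; rewrite -[c in leRHS]ger0_norm// -sqrtr_sqr -sqrtrM ?sqr_ge0//.
exact: ler_wsqrtr.
Qed.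

(** [|x A^T|^2 = <x, (x A^T) A>], so Cauchy-Schwarz turns a bound for [A] into
    one for its transpose. *)
Lemma opbounded_tr n p c (A : 'M[R]_(n, p)) : 0 <= c -> opbounded c A ->
  opbounded c A^T.
Proof.
move=> c0 cA x; set y := x *m A^T.
have H : mxinner y y ^+ 2 <= c ^+ 2 * mxinner y y * mxinner x x.
  rewrite {1}(_ : mxinner y y = mxinner (y *m A) x); last first.
    by rewrite {1}/y mxinner_mulr trmxK mxinnerC.
  apply: (le_trans (mxinner_CS _ _)); by apply: ler_wpM2r; [exact: mxinner_ge0|exact: cA].
have [->|y0] := eqVneq (mxinner y y) 0; first by rewrite mulr_ge0 ?sqr_ge0 ?mxinner_ge0.
have yp : 0 < mxinner y y by rewrite lt_neqAle eq_sym y0 mxinner_ge0.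
by rewrite -(ler_pM2l yp) -expr2 (le_trans H)// mulrAC mulrC mulrA.
Qed.

Lemma opboundedD n p c e (A B : 'M[R]_(n, p)) : 0 <= c -> 0 <= e ->
  opbounded c A -> opbounded e B -> opbounded (c + e) (A + B).
Proof.
move=> c0 e0 cA eB x; rewrite mulmxDr.
have H := mxinner_le (x *m A) (x *m B).
have HA := opboundedW c0 cA x; have HB := opboundedW e0 eB x.
have := cA x; have := eB x.
rewrite !mxinnerL (mxinnerC (x *m B)).
set X := mxinner x x in HA HB *; have X0 : 0 <= X := mxinner_ge0 _.
have : Num.sqrt (mxinner (x *m A) (x *m A)) * Num.sqrt (mxinner (x *m B) (x *m B))
     <= c * Num.sqrt X * (e * Num.sqrt X).
  by rewrite ler_pM ?sqrtr_ge0.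
have -> : c * Num.sqrt X * (e * Num.sqrt X) = c * e * X.
  by rewrite mulrACA -expr2 sqr_sqrtr.
by lra.
Qed.

Lemma opboundedZ n p c a (A : 'M[R]_(n, p)) : opbounded c A ->
  opbounded (a * c) (a *: A).
Proof.
move=> cA x; rewrite -scalemxAr !mxinnerL [leLHS]mulrA -expr2 exprMn -[leRHS]mulrA.
by rewrite ler_wpM2l ?sqr_ge0.
Qed.

Lemma opbounded_le n p c e (A : 'M[R]_(n, p)) : 0 <= c -> c <= e ->
  opbounded c A -> opbounded e A.
Proof.
move=> c0 ce cA x; apply: (le_trans (cA x)).
by rewrite ler_wpM2r ?mxinner_ge0// lerXn2r// nnegrE// (le_trans c0).
Qed.

Lemma row_orthogonal n (U : 'M[R]_n) i : U *m U^T = 1%:M ->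
  mxinner (row i U) (row i U) = 1.
Proof.
move=> /matrixP /(_ i i); rewrite mxinner_row !mxE eqxx mulr1n => <-.
by apply: eq_bigr => j _; rewrite !mxE.
Qed.

Let svd n p (A : 'M[R]_(n, p)) : exists (U : 'M[R]_p) (d : 'rV[R]_p),
  [/\ U *m U^T = 1%:M, A^T *m A = U^T *m diag_mx d *m U,
     nuclear_norm A = \sum_i Num.sqrt (d 0 i),
     forall i, mxinner (row i U *m A^T) (row i U *m A^T) = d 0 i &
     forall i, 0 <= d 0 i].
Proof.
have [|U [d [UU AE]]] := @symmetric_spectral R p (A^T *m A).
  by rewrite trmx_mul trmxK.
have H i : mxinner (row i U *m A^T) (row i U *m A^T) = d 0 i.
  have -> : mxinner (row i U *m A^T) (row i U *m A^T)
      = mxinner (row i U) (row i U *m (A^T *m A)).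
    by rewrite mxinner_mulr trmxK -mulmxA.
  rewrite AE !mulmxA -row_mul UU row1 -rowE row_diag_mx -scalemxAl -rowE.
  by rewrite mxinnerZr row_orthogonal ?mulr1.
exists U, d; split=> //; first exact: nuclear_normE UU AE.
by move=> i; rewrite -H mxinner_ge0.
Qed.

(** Expand [<V, A>] in an orthonormal eigenbasis [u_i] of [A^T A]: it is the sum
    of the [<u_i V^T, u_i A^T>], and the norm of [u_i A^T] is the singular
    value. *)
Lemma nuclear_dual n p (V A : 'M[R]_(n, p)) : opbounded 1 V ->
  mxinner V A <= nuclear_norm A.
Proof.
move=> /(opbounded_tr ler01) cV; have [U [d [UU _ -> dE _]]] := svd A.
have -> : mxinner V A = mxinner (U *m V^T) (U *m A^T).
  by rewrite mxinner_mull mulmxA (mulmx1C UU) mul1mx mxinner_tr.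
rewrite mxinner_rows; apply: ler_sum => i _; rewrite !row_mul.
apply: (le_trans (mxinner_le _ _)); rewrite dE.
rewrite -[leRHS]mul1r ler_wpM2r ?sqrtr_ge0//.
apply: (le_trans (opboundedW ler01 cV _)).
by rewrite mul1r row_orthogonal// sqrtr1.
Qed.

(** Equality holds for the isometric factor of the polar decomposition. *)
Lemma nuclear_dual_attained n p (A : 'M[R]_(n, p)) :
  exists2 W, opbounded 1 W & mxinner W A = nuclear_norm A.
Proof.
have [U [d [UU AE -> dE d0]]] := svd A.
(* a vanishing singular value has inverse [0], which makes [W] a partial
   isometry *)
pose g : 'rV[R]_p := \row_i (Num.sqrt (d 0 i))^-1.
have UU' := mulmx1C UU.
have UAU : U *m (A^T *m A) *m U^T = diag_mx d.
  by rewrite AE !mulmxA UU mul1mx -mulmxA UU mulmx1.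
exists (A *m U^T *m diag_mx g *m U).
  rewrite -[_ *m U]trmxK; apply: opbounded_tr => // x.
  rewrite expr1n mul1r mxinner_mulr trmxK !trmx_mul trmxK tr_diag_mx.
  have -> : x *m (U^T *m (diag_mx g *m (U *m A^T)))
        *m (A *m U^T *m diag_mx g *m U) =
      x *m U^T *m (diag_mx g *m diag_mx d *m diag_mx g) *m U.
    by rewrite -UAU !mulmxA.
  rewrite mxinnerC mxinner_mulr; set z := x *m U^T.
  have <- : mxinner z z = mxinner x x.
    by rewrite /z mxinner_mulr trmxK -mulmxA UU' mulmx1.
  rewrite !mxinnerE !big_ord1; apply: ler_sum => i _.
  rewrite !mulmxA !mul_mx_diag !mxE.
  set y := \sum_j _; rewrite -/y.
  have [e0|e0] := eqVneq (d 0 i) 0.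
    by rewrite e0 mulr0 !mul0r -expr2 sqr_ge0.
  have s0 : Num.sqrt (d 0 i) != 0 by rewrite sqrtr_eq0 -ltNge lt_neqAle eq_sym e0 d0.
  have gdg : (Num.sqrt (d 0 i))^-1 * d 0 i * (Num.sqrt (d 0 i))^-1 = 1.
    by rewrite -[in X in _ * X * _](sqr_sqrtr (d0 i)); field.
  rewrite [leLHS](_ : _ = y * y)//.
  by rewrite -[RHS]mulr1 -gdg; ring.
have -> : mxinner (A *m U^T *m diag_mx g *m U) A = mxinner (diag_mx g) (diag_mx d).
  by rewrite mxinner_mulr mxinner_mull trmx_mul trmxK -UAU !mulmxA.
rewrite /mxinner tr_diag_mx mulmx_diag mxtrace_diag; apply: eq_bigr => i _.
rewrite !mxE -[in X in _ * X](sqr_sqrtr (d0 i)).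
have [->|s0] := eqVneq (Num.sqrt (d 0 i)) 0; first by rewrite expr0n mulr0.
by field.
Qed.
End nuclear.

(** * The oracle inequality *)

Section oracle.
Context {R : realType}.

(** A maximum of linear functions is convex. *)
Lemma nuclear_norm_convex n p (A B : 'M[R]_(n, p)) t : 0 <= t -> t <= 1 ->
  nuclear_norm (A + t *: (B - A)) <= (1 - t) * nuclear_norm A + t * nuclear_norm B.
Proof.
move=> t0 t1; have [W W1 <-] := nuclear_dual_attained (A + t *: (B - A)).
have := nuclear_dual A W1; have := nuclear_dual B W1; rewrite !mxinnerL => HB HA.
have := ler_wpM2l t0 HB; have : 0 <= 1 - t by lra.
by move=> /ler_wpM2l /(_ _ _ HA); lra.
Qed.

Lemma nuclear_dual_le n p c (D A : 'M[R]_(n, p)) : 0 < c -> opbounded c D ->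
  mxinner D A <= c * nuclear_norm A.
Proof.
move=> c0 cD; rewrite -ler_pdivrMl// -mxinnerZl; apply: nuclear_dual.
by rewrite -(mulVf (lt0r_neq0 c0)); exact: opboundedZ.
Qed.

(** The orthogonal projection onto the row space, from the normal equations:
    [B^T (B B^T)^-1 B] for a matrix [B] whose rows form a basis. *)
Lemma row_space_projection n p (A : 'M[R]_(n, p)) : exists Q : 'M[R]_p,
  [/\ Q^T = Q, Q *m Q = Q, A *m Q = A & \tr Q = (\rank A)%:R].
Proof.
have : row_free (row_base A) /\ (A <= row_base A)%MS.
  by rewrite row_base_free eq_row_base.
move: (row_base A) => B [Bfree AB]; pose G := B *m B^T.
have GT : G^T = G by rewrite trmx_mul trmxK.
have Gu : G \in unitmx.
  rewrite -row_free_unit -kermx_eq0; apply/eqP/row_matrixP => i; rewrite row0.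
  have k0 : row i (kermx G) *m G = 0 by rewrite -row_mul mulmx_ker row0.
  have : row i (kermx G) *m B = 0.
    by apply: mxinner_eq0; rewrite mxinner_mulr -mulmxA k0 mxinnerC /mxinner trmx0 mul0mx mxtrace0.
  by move/eqP; rewrite mulmx_free_eq0 // => /eqP.
exists (B^T *m invmx G *m B); split.
- by rewrite !trmx_mul trmxK trmx_inv GT mulmxA.
- by rewrite !mulmxA -(mulmxA _ B) -/G -(mulmxA _ _ G) mulVmx// mulmx1.
- have /submxP[C AE] := AB.
  have BQ : B *m (B^T *m invmx G *m B) = B by rewrite !mulmxA -/G mulmxV// mul1mx.
  by rewrite [X in X *m _ = _]AE -(mulmxA C) BQ -AE.
- by rewrite -mulmxA mxtrace_mulC -mulmxA -/G mulVmx// mxtrace1.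
Qed.

Lemma mxinner_projection n p (P : 'M[R]_n) (D : 'M[R]_(n, p)) c :
  P^T = P -> P *m P = P -> opbounded c D ->
  mxinner (P *m D) (P *m D) <= c ^+ 2 * \tr P.
Proof.
move=> PT PP cD; apply: (le_trans (opbounded_mul _ cD)).
by rewrite /mxinner PT PP.
Qed.

Lemma mxinner_split n p (P : 'M[R]_n) (B : 'M[R]_(n, p)) :
  P^T = P -> P *m P = P ->
  mxinner B B = mxinner (P *m B) (P *m B) + mxinner (B - P *m B) (B - P *m B).
Proof.
move=> PT PP; have E : mxinner B (P *m B) = mxinner (P *m B) (P *m B).
  by rewrite mxinner_mull PT mulmxA PP mxinnerC mxinner_mull PT mxinnerC.
by rewrite !mxinnerL (mxinnerC (P *m B) B) E; ring.
Qed.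

(** The derivative at [0] of a quadratic function that is nonnegative on
    [(0, 1]] and vanishes at [0]. *)
Lemma affine_ge0 (a q : R) : 0 <= q ->
  (forall t, 0 < t -> t <= 1 -> 0 <= a + t * q) -> 0 <= a.
Proof.
move=> q0 H; rewrite leNgt; apply/negP => a0.
pose t := Num.min 1 (- a / (2 * (q + 1))).
have q1 : 0 < 2 * (q + 1) by lra.
have t0 : 0 < t by rewrite lt_min ltr01 divr_gt0// oppr_gt0.
have t1 : t <= 1 by rewrite ge_min lexx.
have tq : t * q <= - a / 2.
  apply: (@le_trans _ _ (- a / (2 * (q + 1)) * q)).
    by rewrite ler_wpM2r// ge_min lexx orbT.
  by rewrite mulrAC ler_pdivrMr//; nra.
by have := H t t0 t1; lra.
Qed.

(** Compare the minimizer with [Mh + t (A - Mh)] and let [t] tend to [0]; the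
    nuclear norm is not differentiable, but convexity replaces its derivative by
    the increment. *)
Lemma first_order n p (Y Mh A : 'M[R]_(n, p)) mu : 0 < mu ->
  (forall B, mxinner Mh Mh - 2 * mxinner Y Mh + mu * nuclear_norm Mh <=
     mxinner B B - 2 * mxinner Y B + mu * nuclear_norm B) ->
  0 <= 2 * mxinner (Mh - Y) (A - Mh) + mu * (nuclear_norm A - nuclear_norm Mh).
Proof.
move=> mu0 H; apply: (@affine_ge0 _ (mxinner (A - Mh) (A - Mh))) => [|t t0 t1].
  exact: mxinner_ge0.
rewrite -(pmulr_rge0 _ t0).
have := H (Mh + t *: (A - Mh)).
have := nuclear_norm_convex Mh A (ltW t0) t1 => /(ler_wpM2l (ltW mu0)).
move: (nuclear_norm _) => N1; move: (nuclear_norm Mh) (nuclear_norm A) => N2 N3.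
rewrite !mxinnerL (mxinnerC A Mh) => H1 H2.
by lra.
Qed.

(** Let [P] and [Q] be the projections onto the column and the row space of [A],
    and [B = Mh - A].  Besides the part that attains the nuclear norm of [A], a
    contraction can act on the complement of these two spaces, where it attains
    the nuclear norm of [(1 - P) B (1 - Q)].  Tested on [Mh], it shows that the
    penalty controls this component of [B], which absorbs the corresponding
    component of the error [D = Y - M].  The remainder of [D] has rank at most
    [2 r], so it costs only the Frobenius norm of [B] times [mu / 2 * sqrt (2 r)],
    and [|B|^2] pays for it. *)
Theorem nuclear_oracle n p (Y M Mh A : 'M[R]_(n, p)) mu : 0 < mu ->
  (forall B, mxinner Mh Mh - 2 * mxinner Y Mh + mu * nuclear_norm Mh <=
     mxinner B B - 2 * mxinner Y B + mu * nuclear_norm B) ->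
  opbounded (mu / 2) (Y - M) ->
  mxinner (Mh - M) (Mh - M) <= mxinner (A - M) (A - M) +
    mu ^+ 2 * ((1 + Num.sqrt 2) / 2) ^+ 2 * (\rank A)%:R.
Proof.
move=> mu0 Hmin HD; set r : R := (\rank A)%:R.
have := first_order A mu0 Hmin.
have [D DE] : exists D, D = Y - M by exists (Y - M).
have [B BE] : exists B, B = Mh - A by exists (Mh - A).
rewrite -DE in HD.
have [Q [QT QQ AQ trQ]] := row_space_projection A.
have [P [PT PP AP trP]] := row_space_projection A^T.
rewrite mxrank_tr in trP.
have PA : P *m A = A by apply: trmx_inj; rewrite trmx_mul PT.
have r0 : 0 <= r by rewrite ler0n.
have mu20 : 0 < mu / 2 by rewrite divr_gt0.
have [W1 W1c W1A] := nuclear_dual_attained A.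
pose V := P *m W1 *m Q.
have compl n' p' (S : 'M[R]_n') (X : 'M[R]_(n', p')) : (1%:M - S) *m X = X - S *m X.
  by rewrite mulmxBl mul1mx.
pose P' := 1%:M - P; pose Q' := 1%:M - Q.
have P'T : P'^T = P' by rewrite linearB/= trmx1 PT.
have Q'T : Q'^T = Q' by rewrite linearB/= trmx1 QT.
have Q'Q : Q' *m Q = 0 by rewrite mulmxBl mul1mx QQ subrr.
have QQ' : Q *m Q' = 0 by rewrite mulmxBr mulmx1 QQ subrr.
have P'P : P' *m P = 0 by rewrite mulmxBl mul1mx PP subrr.
have P'A : P' *m A = 0 by rewrite mulmxBl mul1mx PA subrr.
have P'P' : P' *m P' = P' by rewrite mulmxBr mulmx1 P'P subr0.
have Q'Q' : Q' *m Q' = Q' by rewrite mulmxBr mulmx1 Q'Q subr0.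
have [W2 W2c W2B] := nuclear_dual_attained (P' *m B *m Q').
pose W3 := P' *m W2 *m Q'.
have VA : mxinner V A = nuclear_norm A.
  by rewrite /V mxinner_mulr QT AQ mxinner_mull PT PA.
have W3A : mxinner W3 A = 0.
  by rewrite /W3 -mulmxA mxinner_mull P'T P'A /mxinner mulmx0 mxtrace0.
have W3B : mxinner W3 B = nuclear_norm (P' *m B *m Q').
  by rewrite -W2B /W3 mxinner_mulr Q'T mxinner_mull P'T mulmxA.
have proj_le m (S : 'M[R]_m) k (x : 'M[R]_(m, k)) : S^T = S -> S *m S = S ->
    mxinner (S *m x) (S *m x) <= mxinner x x.
  by move=> ST SS; rewrite (mxinner_split x ST SS) lerDl mxinner_ge0.
have projr_le m (S : 'M[R]_m) k (x : 'M[R]_(k, m)) : S^T = S -> S *m S = S ->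
    mxinner (x *m S) (x *m S) <= mxinner x x.
  move=> ST SS; rewrite -mxinner_tr -(mxinner_tr x) trmx_mul ST; exact: proj_le.
(* a sum of contractions with orthogonal ranges and orthogonal supports *)
have VW3c : opbounded 1 (V + W3).
  move=> x; rewrite expr1n mul1r mulmxDr.
  have -> : mxinner (x *m V + x *m W3) (x *m V + x *m W3) =
      mxinner (x *m V) (x *m V) + mxinner (x *m W3) (x *m W3).
    rewrite !mxinnerL; have -> : mxinner (x *m V) (x *m W3) = 0.
      rewrite /V mulmxA mxinner_mulr /W3 !mulmxA QT -(mulmxA _ Q') Q'Q mulmx0.
      by rewrite mxinnerC /mxinner trmx0 mul0mx mxtrace0.
    have -> : mxinner (x *m W3) (x *m V) = 0.
      rewrite /W3 mulmxA mxinner_mulr /V !mulmxA Q'T -(mulmxA _ Q) QQ' mulmx0.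
      by rewrite mxinnerC /mxinner trmx0 mul0mx mxtrace0.
    by rewrite addr0 add0r.
  have -> : mxinner x x = mxinner (x *m P) (x *m P) + mxinner (x *m P') (x *m P').
    rewrite -mxinner_tr (mxinner_split x^T PT PP) -(compl _ _ P).
    by rewrite -!(mxinner_tr (x *m _)) !trmx_mul PT P'T.
  rewrite lerD//.
    rewrite /V !mulmxA (le_trans (projr_le _ _ _ _ QT QQ))//.
    by rewrite (le_trans (W1c _))// expr1n mul1r.
  rewrite /W3 !mulmxA (le_trans (projr_le _ _ _ _ Q'T Q'Q'))//.
  by rewrite (le_trans (W2c _))// expr1n mul1r.
have HMh : nuclear_norm A + mxinner V B + nuclear_norm (P' *m B *m Q') <=
    nuclear_norm Mh.
  apply: le_trans (nuclear_dual Mh VW3c).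
  have -> : Mh = A + B by rewrite BE addrC subrK.
  by rewrite !mxinnerL VA W3A W3B; lra.
pose b := Num.sqrt (mxinner B B).
have b2 : b ^+ 2 = mxinner B B by rewrite sqr_sqrtr// mxinner_ge0.
have b0 : 0 <= b := sqrtr_ge0 _.
(* [V] factors through [P], so its squared Frobenius norm is at most [r] *)
have HVB : - mxinner V B <= Num.sqrt r * b.
  rewrite -mxinnerNl (le_trans (mxinner_le _ _))// ler_wpM2r// ler_wsqrtr//.
  rewrite mxinnerNl mxinnerNr opprK /V (le_trans (projr_le _ _ _ _ QT QQ))//.
  by rewrite (le_trans (mxinner_projection PT PP W1c))// expr1n mul1r trP.
have HD1 : mxinner D (P' *m B *m Q') <= mu / 2 * nuclear_norm (P' *m B *m Q').
  exact: nuclear_dual_le.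
(* [D - P' D Q' = P D + P' D Q], an orthogonal sum of two matrices of rank [r] *)
have HD2 : mxinner D (B - P' *m B *m Q') <= mu / 2 * Num.sqrt 2 * Num.sqrt r * b.
  have -> : mxinner D (B - P' *m B *m Q') = mxinner (P *m D + P' *m D *m Q) B.
    have -> : P *m D + P' *m D *m Q = D - P' *m D *m Q'.
      rewrite [P' *m D *m Q']mulmxBr mulmx1 [P' *m D]compl.
      by rewrite !opprB [RHS]addrC -addrA subrK addrC.
    rewrite mxinnerDr mxinnerDl mxinnerNr mxinnerNl; congr (_ - _).
    by rewrite mxinnerC mxinner_mulr Q'T mxinner_mull P'T mulmxA mxinnerC.
  rewrite (le_trans (mxinner_le _ _))// ler_wpM2r//.
  have -> : mu / 2 * Num.sqrt 2 * Num.sqrt r = Num.sqrt ((mu / 2) ^+ 2 * r *+ 2).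
    have c0 : 0 <= mu / 2 * Num.sqrt 2 * Num.sqrt r.
      by rewrite mulr_ge0 ?sqrtr_ge0// mulr_ge0 ?sqrtr_ge0// ltW.
    rewrite -[LHS](ger0_norm c0) -sqrtr_sqr.
    by congr Num.sqrt; rewrite !exprMn !sqr_sqrtr// mulrAC mulr_natr.
  rewrite ler_wsqrtr// mulr2n.
  have -> : mxinner (P *m D + P' *m D *m Q) (P *m D + P' *m D *m Q) =
     mxinner (P *m D) (P *m D) + mxinner (P' *m D *m Q) (P' *m D *m Q).
    have PP' : P *m P' = 0 by rewrite mulmxBr mulmx1 PP subrr.
    have PDP' : mxinner (P *m D) (P' *m D *m Q) = 0.
      by rewrite mxinner_mull PT !mulmxA PP' !mul0mx /mxinner mulmx0 mxtrace0.
    rewrite mxinnerDl !mxinnerDr [mxinner (_ *m Q) (P *m D)]mxinnerC PDP'.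
    by rewrite addr0 add0r.
  rewrite lerD//; first by rewrite /r -trP; exact: mxinner_projection.
  rewrite -mulmxA (le_trans (proj_le _ _ _ _ P'T P'P'))// -mxinner_tr trmx_mul QT.
  by rewrite /r -trQ mxinner_projection//; apply: opbounded_tr => //; exact: ltW.
have -> : Mh - Y = Mh - M - D by rewrite DE opprB addrA subrK.
have -> : A - Mh = - B by rewrite BE opprB.
have : mxinner D B = mxinner D (P' *m B *m Q') + mxinner D (B - P' *m B *m Q').
  by rewrite -mxinnerDr addrC subrK.
have : mxinner (Mh - M) (Mh - M) + b ^+ 2 - mxinner (A - M) (A - M)
    = 2 * mxinner (Mh - M) B.
  have -> : A - M = (Mh - M) - B by rewrite BE opprB [RHS]addrC addrA subrK.
  by rewrite b2; move: (Mh - M) => X; rewrite !mxinnerL (mxinnerC B X); ring.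
rewrite [mxinner (Mh - M - D) _]mxinnerDl !mxinnerNl !mxinnerNr.
have r2 : Num.sqrt r ^+ 2 = r by rewrite sqr_sqrtr.
have := ler_wpM2l (ltW mu0) HMh; have := ler_wpM2l (ltW mu0) HVB.
(* complete the square in the Frobenius norm [b] of [B] *)
have := sqr_ge0 (mu * ((1 + Num.sqrt 2) / 2) * Num.sqrt r - b).
have -> : (mu * ((1 + Num.sqrt 2) / 2) * Num.sqrt r - b) ^+ 2 =
  mu ^+ 2 * ((1 + Num.sqrt 2) / 2) ^+ 2 * r
  - mu * Num.sqrt r * b - mu * Num.sqrt 2 * Num.sqrt r * b + b ^+ 2.
  by clear -r2; move: r2; move: (Num.sqrt r) => s <-; field.
by move=> *; lra.
Qed.
End oracle.

(** * Matrix moments by exchangeable pairs *)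

Section scalar.
Context {R : realType}.
Implicit Types a b : R.

(** Young's inequality with exponents [k + 1] and [(k + 1) / k]. *)
Lemma young_pow a b k : 0 <= a -> 0 <= b ->
  k.+1%:R * (a * b ^+ k) <= a ^+ k.+1 + k%:R * b ^+ k.+1.
Proof.
move=> a0 b0; elim: k => [|k IH]; first by rewrite expr0 expr1 mulr1; lra.
have H : 0 <= k.+1%:R * b ^+ k * (b - a) ^+ 2.
  by rewrite mulr_ge0 ?sqr_ge0// mulr_ge0 ?exprn_ge0.
have {}IH := ler_wpM2l a0 IH.
rewrite !exprS in IH *; move: (a ^+ k) (b ^+ k) IH H => x y.
rewrite -!natr1; lra.
Qed.

Let pow_rearrange a b i j : 0 <= a -> 0 <= b ->
  a ^+ i * b ^+ j + a ^+ j * b ^+ i <= a ^+ (i + j) + b ^+ (i + j).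
Proof.
move=> a0 b0; rewrite !exprD.
have : 0 <= (a ^+ i - b ^+ i) * (a ^+ j - b ^+ j).
  have [ab|/ltW ba] := leP a b.
    by rewrite mulr_le0// subr_le0 lerXn2r.
  by rewrite mulr_ge0// subr_ge0 lerXn2r.
lra.
Qed.

(** Divide by [(a - b)^2] and pair each term [a^i b^j] of the resulting geometric
    sum with [a^j b^i]. *)
Lemma mean_value_pow a b k :
  (a - b) * (a ^+ k.*2.+1 - b ^+ k.*2.+1) <=
  k.*2.+1%:R / 2 * (a - b) ^+ 2 * (a ^+ k.*2 + b ^+ k.*2).
Proof.
rewrite subrXX mulrA -expr2 [leRHS]mulrAC [leRHS]mulrC ler_wpM2l ?sqr_ge0//=.
set s := \sum_(i < _) _.
have sE : s = \sum_(i < k.*2.+1) a ^+ i * b ^+ (k.*2 - i).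
  rewrite /s (reindex_inj rev_ord_inj); apply: eq_bigr => i _ /=.
  by rewrite !subSS subKn// -ltnS.
rewrite -(ler_pM2l (ltr0Sn R 1)).
have -> : 2 * s = s + s by rewrite mulr_natl.
rewrite {2}sE /s -big_split/= (_ : 2 * _ = \sum_(i < k.*2.+1) (a ^+ k.*2 + b ^+ k.*2)); last first.
  by rewrite sumr_const card_ord -mulr_natl; field.
apply: ler_sum => i _.
have ik : (i <= k.*2)%N by rewrite -ltnS.
rewrite (le_trans (ler_norm _))// (le_trans (ler_normD _ _))// !normrM !normrX.
rewrite (le_trans (pow_rearrange (k.*2 - i) i (normr_ge0 a) (normr_ge0 b)))//.
by rewrite subnK// -!normrX !ger0_norm// -mul2n mulnC exprM sqr_ge0.
Qed.
End scalar.

Section matrix_powers.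
Context {R : realType}.

Lemma trmxX n (A : 'M[R]_n) k : (A ^+ k)^T = A^T ^+ k.
Proof.
elim: k => [|k IH]; first by rewrite !expr0 trmx1.
by rewrite exprS exprSr trmx_mul IH.
Qed.

Lemma spectral_pow n (U A : 'M[R]_n) (d : 'rV[R]_n) k : U *m U^T = 1%:M ->
  A = U^T *m diag_mx d *m U ->
  A ^+ k = U^T *m diag_mx (\row_i d 0 i ^+ k) *m U.
Proof.
move=> UU AE; elim: k => [|k IH].
  rewrite expr0 (_ : \row_i _ = const_mx 1) ?diag_const_mx ?mulmx1 ?(mulmx1C UU)//.
  by apply/rowP => i; rewrite !mxE expr0.
rewrite exprS IH AE -!mulmxE !mulmxA -[_ *m U *m U^T]mulmxA UU mulmx1.
rewrite -[_ *m diag_mx d *m _]mulmxA mulmx_diag; do 2!congr (_ *m _).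
by congr diag_mx; apply/rowP => i; rewrite !mxE exprS.
Qed.

Lemma mxtrace_spectral_pow n (U A : 'M[R]_n) (d : 'rV[R]_n) k : U *m U^T = 1%:M ->
  A = U^T *m diag_mx d *m U -> \tr (A ^+ k) = \sum_i d 0 i ^+ k.
Proof.
move=> UU AE; rewrite (spectral_pow k UU AE) -mulmxA mxtrace_mulC -mulmxA UU mulmx1.
by rewrite mxtrace_diag; apply: eq_bigr => i _; rewrite mxE.
Qed.

(** In orthonormal eigenbases of [A] and [B], with eigenvalues [a i] and [b j]
    and overlaps [w i j], the entries of [f A - f B] are
    [(f (a i) - f (b j)) * w i j]; the claim is then the scalar mean value
    inequality, term by term. *)
Lemma trace_mean_value n (A B : 'M[R]_n) k : A^T = A -> B^T = B ->
  mxinner (A - B) (A ^+ k.*2.+1 - B ^+ k.*2.+1) <= k.*2.+1%:R / 2 *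
   (mxinner (A ^+ k *m (A - B)) (A ^+ k *m (A - B)) +
    mxinner (B ^+ k *m (A - B)) (B ^+ k *m (A - B))).
Proof.
move=> sA sB; have [U [a [UU AE]]] := symmetric_spectral sA.
have [V [b [VV BE]]] := symmetric_spectral sB.
have UU' := mulmx1C UU; have VV' := mulmx1C VV.
pose w := U *m V^T.
have conj X Y : mxinner X Y = mxinner (U *m X *m V^T) (U *m Y *m V^T).
  by rewrite mxinner_mulr trmxK -!mulmxA VV' mulmx1 mxinner_mull mulmxA UU' mul1mx.
have powA j : U *m A ^+ j = diag_mx (\row_i a 0 i ^+ j) *m U.
  by rewrite (spectral_pow j UU AE) !mulmxA UU mul1mx.
have powB j : B ^+ j *m V^T = V^T *m diag_mx (\row_i b 0 i ^+ j).
  by rewrite (spectral_pow j VV BE) -mulmxA VV mulmx1.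
have diffE j i l : (U *m (A ^+ j - B ^+ j) *m V^T) i l = (a 0 i ^+ j - b 0 l ^+ j) * w i l.
  rewrite mulmxBr mulmxBl powA -(mulmxA _ (B ^+ j)) powB mulmxA -(mulmxA _ U).
  by rewrite -/w mul_diag_mx mul_mx_diag !mxE; ring.
have mxE2 (X : 'I_n -> 'I_n -> R) i l : (\matrix_(i, l) X i l) i l = X i l by rewrite mxE.
have rwE (X : 'I_n -> R) i : (\row_i X i) 0 i = X i by rewrite mxE.
set C := A - B.
have CE i l : (U *m C *m V^T) i l = (a 0 i - b 0 l) * w i l.
  by have := diffE 1%N i l; rewrite !expr1.
have sC : C^T = C by rewrite linearB/= sA sB.
have H1 : mxinner (A ^+ k *m C) (A ^+ k *m C) =
    \sum_i \sum_l (a 0 i - b 0 l) ^+ 2 * w i l ^+ 2 * a 0 i ^+ k.*2.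
  rewrite conj !mulmxA powA -(mulmxA _ U) -(mulmxA _ (U *m C)) mxinnerE.
  apply: eq_bigr => i _; apply: eq_bigr => l _; rewrite mul_diag_mx.
  by rewrite !mxE2 !rwE CE -addnn exprD; ring.
have H2 : mxinner (B ^+ k *m C) (B ^+ k *m C) =
    \sum_i \sum_l (a 0 i - b 0 l) ^+ 2 * w i l ^+ 2 * b 0 l ^+ k.*2.
  rewrite -mxinner_tr trmx_mul trmxX sC sB conj !mulmxA -!(mulmxA _ (B ^+ k)).
  rewrite powB mulmxA mxinnerE; apply: eq_bigr => i _; apply: eq_bigr => l _.
  by rewrite mul_mx_diag !mxE2 !rwE CE -addnn exprD; ring.
rewrite H1 H2 conj mxinnerE -big_split mulr_sumr; apply: ler_sum => i _ /=.
rewrite -big_split mulr_sumr; apply: ler_sum => l _ /=.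
rewrite CE diffE.
have := mean_value_pow (a 0 i) (b 0 l) k => /(ler_wpM2l (sqr_ge0 (w i l))).
by lra.
Qed.
End matrix_powers.

Section moments.
Context {R : realType} (S : finType) (N d : nat) (Z : 'I_N -> S -> 'M[R]_d).
Local Notation sample := {ffun 'I_N -> S}.
Hypothesis Z_sym : forall t s, (Z t s)^T = Z t s.
Hypothesis Z_centered : forall t, \sum_s Z t s = 0.

(** A point [f] of the product space is a sample of [N] independent uniform
    elements of [S]; all expectations below are sums over [f]. *)
Definition sample_sum (f : {ffun 'I_N -> S}) : 'M[R]_d := \sum_t Z t (f t).

Definition resample (t : 'I_N) (s : S) (f : {ffun 'I_N -> S}) :
    {ffun 'I_N -> S} := [ffun u => if u == t then s else f u].

Let swap t (q : {ffun 'I_N -> S} * S) := (resample t q.2 q.1, q.1 t).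

Let swapK t : involutive (swap t).
Proof.
move=> [f s]; rewrite /swap /= /resample; congr pair; last by rewrite ffunE eqxx.
by apply/ffunP => u; rewrite !ffunE; case: eqP => // ->.
Qed.

Let sum_swap t (F : {ffun 'I_N -> S} -> S -> R) :
  \sum_(f : sample) \sum_s F f s = \sum_(f : sample) \sum_s F (resample t s f) (f t).
Proof.
rewrite (pair_bigA _ F) pair_bigA /=.
by rewrite (reindex_inj (inv_inj (swapK t))).
Qed.

Let sample_sum_resample t s f : sample_sum f - sample_sum (resample t s f) = Z t (f t) - Z t s.
Proof.
rewrite /sample_sum (bigD1 t)//= [X in _ - X](bigD1 t)//= ffunE eqxx.
rewrite opprD addrACA -sumrB big1 ?addr0// => u ut.
by rewrite ffunE (negPf ut) subrr.
Qed.

Let sample_sum_sym f : (sample_sum f)^T = sample_sum f.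
Proof. by rewrite /sample_sum raddf_sum; apply: eq_bigr => t _; rewrite /= Z_sym. Qed.

Let noise k f t s := mxinner (sample_sum f ^+ k *m (Z t (f t) - Z t s))
                             (sample_sum f ^+ k *m (Z t (f t) - Z t s)).

(** As [Z t] is centered, [Z t (f t)] may be replaced by [Z t (f t) - Z t s] with
    [s] an independent copy.  Exchanging [f t] and [s] changes the sign of this
    difference, hence twice the sum pairs it with the increment of the power of
    the sum, to which [trace_mean_value] applies. *)
Let exchange k t :
  \sum_(f : sample) \sum_(s : S) mxinner (Z t (f t)) (sample_sum f ^+ k.*2.+1) <=
  k.*2.+1%:R / 2 * \sum_(f : sample) \sum_s noise k f t s.
Proof.
pose G f := sample_sum f ^+ k.*2.+1.
have E1 : \sum_(f : sample) \sum_(s : S) mxinner (Z t (f t)) (G f) =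
    \sum_(f : sample) \sum_s mxinner (Z t (f t) - Z t s) (G f).
  apply: eq_bigr => f _; under [RHS]eq_bigr do rewrite mxinnerDl mxinnerNl.
  rewrite big_split/= -[LHS]addr0; congr (_ + _).
  rewrite -[LHS](_ : - mxinner (\sum_s Z t s) (G f) = 0); last first.
    by rewrite Z_centered /mxinner trmx0 mul0mx mxtrace0 oppr0.
  rewrite sumrN; congr (- _).
  by rewrite /mxinner raddf_sum/= mulmx_suml raddf_sum.
rewrite -(ler_pM2l (ltr0Sn R 1)) E1.
have -> : 2 * (\sum_(f : sample) \sum_s mxinner (Z t (f t) - Z t s) (G f)) =
    \sum_(f : sample) \sum_s mxinner (Z t (f t) - Z t s) (G f - G (resample t s f)).
  rewrite mulr_natl mulr2n {2}(sum_swap t) -big_split; apply: eq_bigr => f _.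
  rewrite -big_split; apply: eq_bigr => s _ /=.
  by rewrite ffunE eqxx mxinnerDr mxinnerNr -[Z t s - _]opprB mxinnerNl.
apply: (@le_trans _ _ (\sum_(f : sample) \sum_s (k.*2.+1%:R / 2 *
    (noise k f t s + noise k (resample t s f) t (f t))))).
  apply: ler_sum => f _; apply: ler_sum => s _.
  have := trace_mean_value k (sample_sum_sym f) (sample_sum_sym (resample t s f)).
  rewrite sample_sum_resample -/(G f) -/(G _) => /le_trans; apply.
  rewrite /noise ffunE eqxx.
  rewrite -(opprB (Z t s)) !mulmxN !mxinnerNl !mxinnerNr !opprK.
  by [].
under eq_bigr => f _ do under eq_bigr => s _ do rewrite mulrDr.
under eq_bigr => f _ do rewrite big_split/=.
rewrite big_split/= -(sum_swap t (fun f s => k.*2.+1%:R / 2 * noise k f t s)).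
rewrite -mulr2n -[leLHS]mulr_natl ler_wpM2l// mulr_sumr.
by apply: ler_sum => f _; rewrite mulr_sumr.
Qed.

Let trace_even_pow f k : \tr (sample_sum f ^+ k.*2) = mxinner (sample_sum f ^+ k) (sample_sum f ^+ k).
Proof. by rewrite /mxinner trmxX sample_sum_sym -addnn exprD. Qed.

Variable delta : {ffun 'I_N -> S} -> R.
Hypothesis S_gt0 : (0 < #|S|)%N.
Hypothesis delta_ge0 : forall f, 0 <= delta f.
Hypothesis Z_var : forall (f : sample) (x : 'rV[R]_d),
  \sum_t \sum_s mxinner (x *m (Z t (f t) - Z t s)) (x *m (Z t (f t) - Z t s))
    <= 2 * #|S|%:R * delta f * mxinner x x.

Let moment_step k :
  \sum_(f : sample) \tr (sample_sum f ^+ k.+1.*2) <=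
  k.*2.+1%:R * \sum_(f : sample) delta f * \tr (sample_sum f ^+ k.*2).
Proof.
have S0 : (0 : R) < #|S|%:R by rewrite ltr0n.
rewrite -(ler_pM2l S0).
have -> : #|S|%:R * \sum_(f : sample) \tr (sample_sum f ^+ k.+1.*2) =
    \sum_t \sum_(f : sample) \sum_(s : S) mxinner (Z t (f t)) (sample_sum f ^+ k.*2.+1).
  rewrite [RHS]exchange_big mulr_sumr /=; apply: eq_bigr => f _.
  rewrite exchange_big/= sumr_const -[RHS]mulr_natl; congr (_ * _).
  rewrite doubleS exprS {1}/sample_sum mulr_suml raddf_sum; apply: eq_bigr => t _.
  by rewrite /mxinner Z_sym.
have /le_trans : \sum_t \sum_(f : sample) \sum_(s : S) mxinner (Z t (f t)) (sample_sum f ^+ k.*2.+1)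
    <= \sum_t (k.*2.+1%:R / 2 * \sum_(f : sample) \sum_s noise k f t s).
  by apply: ler_sum => t _; exact: exchange.
apply; rewrite -mulr_sumr exchange_big/=.
have : \sum_(f : sample) \sum_t \sum_s noise k f t s <=
    \sum_(f : sample) (2 * #|S|%:R * (delta f * \tr (sample_sum f ^+ k.*2))).
  apply: ler_sum => f _; rewrite trace_even_pow [mxinner (_ ^+ k) _]mxinner_rows.
  rewrite mulrA mulr_sumr.
  have -> : \sum_t \sum_s noise k f t s = \sum_i \sum_t \sum_s
      mxinner (row i (sample_sum f ^+ k) *m (Z t (f t) - Z t s))
              (row i (sample_sum f ^+ k) *m (Z t (f t) - Z t s)).
    rewrite [RHS]exchange_big/=; apply: eq_bigr => t _; rewrite [RHS]exchange_big/=.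
    apply: eq_bigr => s _; rewrite /noise mxinner_rows; apply: eq_bigr => i _.
    by rewrite row_mul.
  by apply: ler_sum => i _; exact: Z_var.
rewrite -mulr_sumr => H.
have := ler_wpM2l (divr_ge0 (ler0n R k.*2.+1) (ler0n R 2)) H.
by move=> /le_trans; apply; rewrite le_eqVlt; apply/orP; left; apply/eqP; field.
Qed.

(** A Burkholder-type bound: [delta f] dominates the conditional variance, the
    average over the resampled values of half the squared increments.  Young's
    inequality, applied to each eigenvalue, absorbs the lower moment in
    [moment_step] into the left side. *)
Theorem matrix_moment k :
  \sum_(f : sample) \tr (sample_sum f ^+ k.+1.*2) <=
  d%:R * k.*2.+1%:R ^+ k.+1 * \sum_(f : sample) delta f ^+ k.+1.
Proof.
have step f : k.+1%:R * (k.*2.+1%:R * (delta f * \tr (sample_sum f ^+ k.*2))) <=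
    d%:R * k.*2.+1%:R ^+ k.+1 * delta f ^+ k.+1 + k%:R * \tr (sample_sum f ^+ k.+1.*2).
  have [U [b [UU BE]]] := symmetric_spectral (sample_sum_sym f).
  rewrite !(mxtrace_spectral_pow _ UU BE).
  have -> : d%:R * k.*2.+1%:R ^+ k.+1 * delta f ^+ k.+1 =
      \sum_(i < d) (k.*2.+1%:R * delta f) ^+ k.+1.
    by rewrite sumr_const card_ord -[RHS]mulr_natl exprMn mulrA.
  rewrite !mulr_sumr -big_split; apply: ler_sum => i _ /=.
  rewrite -!mul2n !exprM [X in _ * X <= _]mulrA.
  by apply: young_pow; [exact: mulr_ge0|exact: sqr_ge0].
have := ler_wpM2l (ler0n R k.+1) (moment_step k).
have : \sum_(f : sample) (k.+1%:R * (k.*2.+1%:R * (delta f * \tr (sample_sum f ^+ k.*2)))) <=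
  \sum_(f : sample) (d%:R * k.*2.+1%:R ^+ k.+1 * delta f ^+ k.+1 + k%:R * \tr (sample_sum f ^+ k.+1.*2)).
  by apply: ler_sum => f _; exact: step.
rewrite big_split/= -!mulr_sumr => H1 H2.
have := le_trans H2 H1; rewrite -[k.+1%:R]natr1; lra.
Qed.
End moments.

(** * Symmetric dilation and sampled cells *)

Section dilation.
Context {R : realType}.

Definition dilation n p (A : 'M[R]_(n, p)) : 'M[R]_(n + p) :=
  block_mx 0 A A^T 0.

Lemma dilation_sym n p (A : 'M[R]_(n, p)) : (dilation A)^T = dilation A.
Proof. by rewrite tr_block_mx !trmx0 trmxK. Qed.

Lemma dilationD n p (A B : 'M[R]_(n, p)) : dilation (A + B) = dilation A + dilation B.
Proof. by rewrite /dilation add_block_mx !addr0 linearD. Qed.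

Lemma dilationZ n p a (A : 'M[R]_(n, p)) : dilation (a *: A) = a *: dilation A.
Proof. by rewrite /dilation scale_block_mx !scaler0 linearZ. Qed.

Lemma dilation0 n p : dilation (0 : 'M[R]_(n, p)) = 0.
Proof. by rewrite /dilation trmx0 block_mx0. Qed.

Lemma dilation_sum n p (I : finType) (A : I -> 'M[R]_(n, p)) :
  dilation (\sum_i A i) = \sum_i dilation (A i).
Proof. exact: (big_morph _ (@dilationD n p) (@dilation0 n p)). Qed.

Lemma mxinner_row_mx n p (a c : 'rV[R]_n) (b d : 'rV[R]_p) :
  mxinner (row_mx a b) (row_mx c d) = mxinner a c + mxinner b d.
Proof. by rewrite !mxinner_row tr_row_mx mul_row_col mxE. Qed.

(** The spectrum of the dilation is that of [A] with signs, and an even power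
    sum of eigenvalues bounds each of them. *)
Lemma dilation_opbounded n p (A : 'M[R]_(n, p)) s k : 0 <= s ->
  \tr (dilation A ^+ k.+1.*2) <= s ^+ k.+1.*2 -> opbounded s A.
Proof.
move=> s0; have [U [d [UU AE]]] := symmetric_spectral (dilation_sym A).
rewrite (mxtrace_spectral_pow _ UU AE) => H.
have d_le i : d 0 i ^+ 2 <= s ^+ 2.
  rewrite -(@ler_pXn2r _ k.+1) ?nnegrE ?sqr_ge0// -!exprM mul2n.
  apply: le_trans H; rewrite (bigD1 i)//= lerDl sumr_ge0// => j _.
  by rewrite -mul2n exprM exprn_ge0// sqr_ge0.
have bound (x : 'rV[R]_(n + p)) :
    mxinner (x *m dilation A) (x *m dilation A) <= s ^+ 2 * mxinner x x.
  have <- : mxinner (x *m U^T) (x *m U^T) = mxinner x x.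
    by rewrite mxinner_mulr trmxK -mulmxA (mulmx1C UU) mulmx1.
  have -> : mxinner (x *m dilation A) (x *m dilation A) =
      mxinner (x *m U^T *m diag_mx d) (x *m U^T *m diag_mx d).
    by rewrite AE !mulmxA mxinner_mulr -[_ *m U *m U^T]mulmxA UU mulmx1.
  rewrite !mxinnerE !big_ord1 mulr_sumr; apply: ler_sum => i _.
  rewrite mul_mx_diag mxE; set y := (_ *m _) 0 i.
  by rewrite mulrACA -!expr2 mulrC ler_wpM2r ?sqr_ge0.
move=> x; have := bound (row_mx x 0).
rewrite /dilation mul_row_block !mxinner_row_mx !(mulmx0, mul0mx, addr0, add0r).
by rewrite {1 4}/mxinner !trmx0 !mul0mx !mxtrace0 add0r addr0.
Qed.

(** The first [n] coordinates of the dilation stand for rows and the last [p] for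
    columns; the square of the dilation of a cell is the diagonal matrix that
    indicates its row and its column. *)
Definition touches n p (q : 'I_n * 'I_p) (i : 'I_(n + p)) : bool :=
  (i == lshift p q.1) || (i == rshift n q.2).

Definition cell n p (q : 'I_n * 'I_p) : 'M[R]_(n, p) := delta_mx q.1 q.2.

Lemma mxinner_dilation_cell n p (q : 'I_n * 'I_p) (x : 'rV[R]_(n + p)) :
  mxinner (x *m dilation (cell q)) (x *m dilation (cell q)) =
  \sum_i (touches q i)%:R * x 0 i ^+ 2.
Proof.
rewrite -[in LHS](hsubmxK x) /dilation mul_row_block !mulmx0 addr0 add0r.
rewrite mxinner_row_mx big_split_ord addrC /=; congr (_ + _).
  rewrite /cell mxinnerE big_ord1 (bigD1 q.2)//= [RHS](bigD1 q.1)//=.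
  rewrite /touches eqxx mul1r !big1 ?addr0; first last.
  - move=> j jq; rewrite mxE big1 ?mul0r// => l _.
    by rewrite !mxE (negPf jq) andbF mulr0.
  - move=> i iq; rewrite (inj_eq (@lshift_inj _ _)) (negPf iq) eq_lrshift mul0r//.
  rewrite mxE (bigD1 q.1)//= big1 ?addr0 => [|l lq].
    by rewrite !mxE !eqxx mulr1 expr2.
  by rewrite !mxE (negPf lq) mulr0.
rewrite /cell mxinnerE big_ord1 (bigD1 q.1)//= [RHS](bigD1 q.2)//=.
rewrite /touches eqxx orbT mul1r !big1 ?addr0; first last.
- move=> j jq; rewrite mxE big1 ?mul0r// => l _.
  by rewrite !mxE (negPf jq) mulr0.
- by move=> i iq; rewrite (inj_eq (@rshift_inj _ _)) (negPf iq) orbF eq_rlshift mul0r.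
rewrite mxE (bigD1 q.2)//= big1 ?addr0 => [|l lq].
  by rewrite !mxE !eqxx mulr1 expr2.
by rewrite !mxE (negPf lq) andbF mulr0.
Qed.

(** A row has [p] of the [n p] cells and a column [n], so at most a proportion
    [1 / min (n, p)] in both cases. *)
Lemma sum_touches n p (i : 'I_(n + p)) :
  (minn n p)%:R * \sum_(q : 'I_n * 'I_p) (touches q i)%:R <= (n * p)%:R :> R.
Proof.
rewrite -natr_sum -natrM ler_nat -(pair_bigA _ (fun a b => nat_of_bool (touches (a, b) i)))/=.
rewrite /touches; case: (split_ordP i) => j ->.
  rewrite (bigD1 j)//= [X in (_ * (_ + X))%N]big1 ?addn0 => [|a aj]; last first.
    by rewrite big1// => b _; rewrite (inj_eq (@lshift_inj _ _)) [j == a]eq_sym (negPf aj) eq_lrshift.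
  rewrite (eq_bigr (fun _ => 1%N)) => [|b _]; last by rewrite eqxx.
  by rewrite sum1_card card_ord leq_mul2r geq_minl orbT.
rewrite exchange_big (bigD1 j)//= [X in (_ * (_ + X))%N]big1 ?addn0 => [|a aj]; last first.
  by rewrite big1// => b _; rewrite (inj_eq (@rshift_inj _ _)) [j == a]eq_sym (negPf aj) eq_rlshift.
rewrite (eq_bigr (fun _ => 1%N)) => [|b _]; last by rewrite eqxx orbT.
by rewrite sum1_card card_ord mulnC leq_mul2l geq_minr orbT.
Qed.

End dilation.

(** * Fluctuation of the sampled cells *)

Section counting.
Context {R : realType}.

Lemma sum_ffun_prod (I S : finType) (g : I -> S -> R) :
  \sum_(f : {ffun I -> S}) \prod_i g i (f i) = \prod_i \sum_s g i s.
Proof. by rewrite bigA_distr_bigA. Qed.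

Lemma pow_le_expR (y : R) k : 0 <= y -> y ^+ k <= expR (k%:R * (y - 1)).
Proof.
move=> y0; rewrite mulrC expRM_natr lerXn2r ?nnegrE ?expR_ge0//.
by have := expR_ge1Dx (y - 1); rewrite addrC subrK.
Qed.

Lemma expR_le_affine (u : R) : 0 <= u -> u <= 2^-1 -> expR u <= 1 + 2 * u.
Proof.
move=> u0 u1; have H := expR_ge1Dx (- u).
have e0 := expR_gt0 u.
have E : expR u * expR (- u) = 1 by rewrite -expRD subrr expR0.
have : expR u * (1 - u) <= 1 by rewrite -[leRHS]E ler_wpM2l ?expR_ge0.
nra.
Qed.

Context (n p N : nat).
Hypothesis n_gt0 : (0 < n)%N.
Hypothesis p_gt0 : (0 < p)%N.
Local Notation sample := {ffun 'I_N -> 'I_n * 'I_p}.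
Local Notation L := (N%:R / (minn n p)%:R : R).

Let min_gt0 : (0 : R) < (minn n p)%:R.
Proof. by rewrite ltr0n leq_min n_gt0. Qed.

Let np_gt0 : (0 : R) < (n * p)%:R.
Proof. by rewrite ltr0n muln_gt0 n_gt0. Qed.

(** Moment generating function of the number of visits of a coordinate, in the
    form of the Poisson bound [exp (L (B - 1))]; the parameter [B] can be [exp u],
    or the exponential moment of a random weight. *)
Lemma touches_mgf (i : 'I_(n + p)) B : 1 <= B ->
  (\sum_(q : 'I_n * 'I_p) (if touches q i then B else 1)) ^+ N <=
  (n * p)%:R ^+ N * expR (L * (B - 1)).
Proof.
move=> B1; have -> : expR (L * (B - 1)) = expR ((minn n p)%:R^-1 * (B - 1)) ^+ N.
  by rewrite -expRM_natl; congr expR; ring.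
rewrite -exprMn; apply: lerXn2r; rewrite ?nnegrE.
- by apply: sumr_ge0 => q _; case: ifP => _ //; exact: le_trans ler01 B1.
- by rewrite mulr_ge0 ?expR_ge0.
have -> : \sum_(q : 'I_n * 'I_p) (if touches q i then B else 1) =
    (n * p)%:R + (B - 1) * \sum_(q : 'I_n * 'I_p) (touches q i)%:R.
  rewrite mulr_sumr -[(n * p)%:R](_ : \sum_(q : 'I_n * 'I_p) 1 = _); last first.
    by rewrite sumr_const card_prod !card_ord.
  rewrite -big_split; apply: eq_bigr => q _ /=.
  by case: ifP => _; rewrite ?mulr1 ?mulr0 ?addr0// addrC subrK.
have B0 : 0 <= B - 1 by rewrite subr_ge0.
have H : \sum_(q : 'I_n * 'I_p) (touches q i)%:R <= (n * p)%:R / (minn n p)%:R :> R.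
  by rewrite ler_pdivlMr// mulrC sum_touches.
apply: le_trans (_ : (n * p)%:R * (1 + (minn n p)%:R^-1 * (B - 1)) <= _); last first.
  by rewrite ler_wpM2l// expR_ge1Dx.
by have := ler_wpM2l B0 H; lra.
Qed.

Definition hits (f : sample) (i : 'I_(n + p)) : R := \sum_t (touches (f t) i)%:R.

(** A power is at most an exponential, [y^k <= exp (k (y - 1))], at the scale
    [8 L]: large enough for [expR_le_affine] to apply when [k <= 4 L]. *)
Lemma hits_moment (i : 'I_(n + p)) k : (0 < N)%N -> k%:R <= 4 * L ->
  \sum_f (hits f i + L) ^+ k <= (n * p)%:R ^+ N * (8 * L) ^+ k.
Proof.
move=> N0 kL; have L0 : 0 < L by rewrite divr_gt0// ltr0n.
have [l lE] : exists l, l = L by exists L.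
rewrite -lE in kL L0 *.
have mgf := touches_mgf i; rewrite -lE in mgf.
pose u := k%:R / (8 * l).
have u0 : 0 <= u by rewrite divr_ge0 ?mulr_ge0// ltW.
have u1 : u <= 2^-1 by rewrite ler_pdivrMr ?mulr_gt0//; lra.
have hits0 (f : sample) : 0 <= hits f i by apply: sumr_ge0.
have step (f : sample) : (hits f i + l) ^+ k <=
    (8 * l) ^+ k * expR (k%:R * (8^-1 - 1)) * expR (u * hits f i).
  rewrite -mulrA -expRD.
  have -> : hits f i + l = (8 * l) * ((hits f i + l) / (8 * l)).
    by rewrite mulrC divfK// gt_eqF// mulr_gt0.
  rewrite exprMn ler_wpM2l ?exprn_ge0 ?mulr_ge0 ?(ltW L0)//.
  apply: (le_trans (pow_le_expR _ _)); first by rewrite divr_ge0 ?addr_ge0 ?mulr_ge0 ?(ltW L0).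
  rewrite ler_expR /u le_eqVlt; apply/orP; left; apply/eqP; field.
  by rewrite gt_eqF.
apply: (le_trans (ler_sum _ (fun f _ => step f))).
rewrite -mulr_sumr.
have -> : \sum_(f : sample) expR (u * hits f i) =
    (\sum_(q : 'I_n * 'I_p) (if touches q i then expR u else 1)) ^+ N.
  rewrite -[in RHS](card_ord N) -prodr_const -sum_ffun_prod.
  apply: eq_bigr => f _; rewrite /hits mulr_sumr expR_sum; apply: eq_bigr => t _.
  by case: ifP => _; rewrite ?mulr1 ?mulr0 ?expR0.
have B1 : 1 <= expR u by rewrite -expR0 ler_expR.
have c0 : 0 <= (8 * l) ^+ k * expR (k%:R * (8^-1 - 1)).
  by rewrite mulr_ge0 ?expR_ge0 ?exprn_ge0 ?mulr_ge0 ?(ltW L0).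
apply: (le_trans (ler_wpM2l c0 (mgf _ B1))).
rewrite [leLHS]mulrCA ler_wpM2l ?exprn_ge0// -mulrA -[leRHS]mulr1.
rewrite ler_wpM2l ?exprn_ge0 ?mulr_ge0 ?(ltW L0)// -expRD -[leRHS]expR0 ler_expR.
have Hu : l * (expR u - 1) <= l * (2 * u).
  by rewrite ler_wpM2l ?(ltW L0)//; have := expR_le_affine u0 u1; lra.
have E : l * (2 * u) = k%:R / 4 by rewrite /u; field; rewrite gt_eqF.
have : (0 : R) <= k%:R by [].
by rewrite E in Hu; lra.
Qed.

Definition centered_cell (M : 'M[R]_(n, p)) (q : 'I_n * 'I_p) : 'M[R]_(n + p) :=
  M q.1 q.2 *: dilation (cell q) - (n * p)%:R^-1 *: dilation M.

Lemma sum_cells (M : 'M[R]_(n, p)) : \sum_(q : 'I_n * 'I_p) M q.1 q.2 *: cell q = M.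
Proof.
by rewrite -(pair_bigA _ (fun i j => M i j *: cell (i, j)))/= -matrix_sum_delta.
Qed.

(** The conditional variance is diagonal, and bounded by [b^2] times the number
    of visits of a coordinate plus the expected number. *)
Lemma sampling_moment (M : 'M[R]_(n, p)) b k : (0 < N)%N -> 0 <= b ->
  (forall i j, `|M i j| <= b) -> k.+1%:R <= 4 * L ->
  \sum_f \tr (sample_sum (fun _ : 'I_N => centered_cell M) f ^+ k.+1.*2) <=
  (n + p)%:R ^+ 2 * (16 * k.+1%:R * b ^+ 2 * L) ^+ k.+1 * (n * p)%:R ^+ N.
Proof.
move=> N0 b0 Mb kL; have L0 : 0 < L by rewrite divr_gt0// ltr0n.
have [l lE] : exists l, l = L by exists L.
rewrite -lE in kL L0 *.
have hits0 (f : sample) i : 0 <= hits f i by apply: sumr_ge0.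
pose e (f : sample) i := b ^+ 2 * (hits f i + l).
have e0 f i : 0 <= e f i by rewrite mulr_ge0 ?sqr_ge0// addr_ge0 ?(ltW L0).
pose delta (f : sample) := \big[Num.max/0]_i e f i.
have e_le f i : e f i <= delta f by rewrite /delta (bigD1 i)//= le_max lexx.
have delta0 f : 0 <= delta f.
  by rewrite /delta; elim/big_ind: _ => // x y x0 y0; rewrite le_max x0.
have delta_pow f : delta f ^+ k.+1 <= \sum_i e f i ^+ k.+1.
  rewrite /delta; elim/big_ind: _ => [|x y Hx Hy|i _].
  - by rewrite expr0n /=; apply: sumr_ge0 => i _; rewrite exprn_ge0.
  - by rewrite maxEle; case: ifP.
  - by rewrite (bigD1 i)//= lerDl; apply: sumr_ge0 => j _; rewrite exprn_ge0.
have Zsym q : (centered_cell M q)^T = centered_cell M q.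
  by rewrite /centered_cell linearB/= !linearZ/= !dilation_sym.
have Zcen : \sum_q centered_cell M q = 0.
  rewrite /centered_cell sumrB sumr_const card_prod !card_ord -scaler_nat scalerA.
  rewrite mulfV ?gt_eqF// scale1r; under eq_bigr do rewrite -dilationZ.
  by rewrite -dilation_sum sum_cells subrr.
have card_cells : #|{: 'I_n * 'I_p}| = (n * p)%N by rewrite card_prod !card_ord.
have := @matrix_moment R ('I_n * 'I_p)%type N (n + p) (fun _ => centered_cell M)
  (fun _ => Zsym) (fun _ => Zcen) delta.
rewrite card_cells => /(_ _ delta0) H.
apply: le_trans (H _ _ k) _; first by rewrite muln_gt0 n_gt0.
  move=> f x.
  have cell_le q r : mxinner (x *m (centered_cell M q - centered_cell M r))
      (x *m (centered_cell M q - centered_cell M r)) <=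
      2 * b ^+ 2 * \sum_i ((touches q i)%:R + (touches r i)%:R) * x 0 i ^+ 2.
    have -> : centered_cell M q - centered_cell M r =
        M q.1 q.2 *: dilation (cell q) - M r.1 r.2 *: dilation (cell r).
      by rewrite /centered_cell opprB addrA subrK.
    have -> : \sum_i ((touches q i)%:R + (touches r i)%:R) * x 0 i ^+ 2 =
        mxinner (x *m dilation (cell q)) (x *m dilation (cell q)) +
        mxinner (x *m dilation (cell r)) (x *m dilation (cell r)).
      by rewrite !mxinner_dilation_cell -big_split; apply: eq_bigr => i _; rewrite mulrDl.
    have Mb2 i j : M i j ^+ 2 <= b ^+ 2.
      by rewrite -real_normK ?num_real// lerXn2r ?nnegrE.
    rewrite mulmxBr -!scalemxAr; move: (x *m dilation (cell q)) (x *m dilation (cell r)) => y z.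
    have := mxinner_ge0 (M q.1 q.2 *: y + M r.1 r.2 *: z).
    have := ler_wpM2r (mxinner_ge0 y) (Mb2 q.1 q.2).
    have := ler_wpM2r (mxinner_ge0 z) (Mb2 r.1 r.2).
    rewrite !mxinnerL (mxinnerC z y); lra.
  apply: (@le_trans _ _ (\sum_t \sum_r 2 * b ^+ 2 *
      \sum_i ((touches (f t) i)%:R + (touches r i)%:R) * x 0 i ^+ 2)).
    by apply: ler_sum => t _; apply: ler_sum => r _; exact: cell_le.
  under eq_bigr do rewrite -mulr_sumr.
  have -> : 2 * (n * p)%:R * delta f * mxinner x x =
      2 * ((n * p)%:R * delta f * mxinner x x) by ring.
  rewrite -mulr_sumr -[leLHS]mulrA ler_wpM2l//.
  have -> : \sum_t \sum_r \sum_i ((touches (f t) i)%:R + (touches r i)%:R) * x 0 i ^+ 2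
     = \sum_i ((n * p)%:R * hits f i + N%:R * \sum_(r : 'I_n * 'I_p) (touches r i)%:R) * x 0 i ^+ 2.
    rewrite -card_cells.
    transitivity (\sum_i \sum_t \sum_(r : 'I_n * 'I_p)
        ((touches (f t) i)%:R + (touches r i)%:R) * x 0 i ^+ 2).
      rewrite [RHS]exchange_big/=; apply: eq_bigr => t _.
      by rewrite [RHS]exchange_big.
    apply: eq_bigr => i _.
    have split_r (t : 'I_N) :
        \sum_(r : 'I_n * 'I_p) ((touches (f t) i)%:R + (touches r i)%:R) =
        #|{: 'I_n * 'I_p}|%:R * (touches (f t) i)%:R
        + \sum_(r : 'I_n * 'I_p) (touches r i)%:R :> R.
      by rewrite big_split/= sumr_const mulr_natl.
    have nS (c : R) : N%:R * c = \sum_(t < N) c.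
      by rewrite sumr_const card_ord mulr_natl.
    rewrite /hits mulr_sumr nS -big_split/= mulr_suml; apply: eq_bigr => t _.
    by rewrite -mulr_suml split_r.
  rewrite mxinnerE big_ord1 !mulr_sumr; apply: ler_sum => i _.
  rewrite -expr2 [leLHS]mulrA; apply: ler_wpM2r; first exact: sqr_ge0.
  have := e_le f i => /(ler_wpM2l (ltW np_gt0)); apply: le_trans.
  rewrite /e [leRHS]mulrCA ler_wpM2l ?sqr_ge0// mulrDr lerD2l.
  rewrite lE [leRHS]mulrCA ler_wpM2l// ler_pdivlMr// mulrC.
  exact: sum_touches.
have powers : \sum_f delta f ^+ k.+1 <=
    (n + p)%:R * ((n * p)%:R ^+ N * (b ^+ 2 * (8 * l)) ^+ k.+1).
  apply: (le_trans (ler_sum _ (fun f _ => delta_pow f))).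
  have cd (c : R) : (n + p)%:R * c = \sum_(i < n + p) c.
    by rewrite sumr_const card_ord mulr_natl.
  rewrite exchange_big/= cd.
  apply: ler_sum => i _; under eq_bigr do rewrite exprMn.
  rewrite -mulr_sumr [X in _ <= _ * X]exprMn [leRHS]mulrCA ler_wpM2l ?exprn_ge0 ?sqr_ge0//.
  by rewrite lE; apply: hits_moment; rewrite -?lE.
have c0 : 0 <= (n + p)%:R * k.*2.+1%:R ^+ k.+1 :> R by rewrite mulr_ge0 ?exprn_ge0.
apply: (le_trans (ler_wpM2l c0 powers)).
have -> : (n + p)%:R ^+ 2 * (16 * k.+1%:R * b ^+ 2 * l) ^+ k.+1 * (n * p)%:R ^+ N =
  (n + p)%:R * (2 * k.+1%:R) ^+ k.+1 *
   ((n + p)%:R * ((n * p)%:R ^+ N * (b ^+ 2 * (8 * l)) ^+ k.+1)).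
  have -> : 16 * k.+1%:R * b ^+ 2 * l = (2 * k.+1%:R) * (b ^+ 2 * (8 * l)) by ring.
  by rewrite [_ ^+ k.+1 in LHS]exprMn; ring.
rewrite ler_wpM2r//.
  by rewrite mulr_ge0// mulr_ge0 ?exprn_ge0// mulr_ge0 ?sqr_ge0// mulr_ge0// ltW.
rewrite ler_wpM2l// lerXn2r// ?nnegrE ?mulr_ge0// -natrM ler_nat.
by rewrite mul2n doubleS.
Qed.
End counting.

(** * Random signs *)

Section rademacher.
Context {R : realType}.

Lemma finite_markov (I : finType) (X : I -> R) (c : R) : 0 < c -> (forall f, 0 <= X f) ->
  \sum_f (c < X f)%R%:R <= c^-1 * \sum_f X f :> R.
Proof.
move=> c0 X0; rewrite mulr_sumr; apply: ler_sum => f _.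
case: (ltP c (X f)) => [/ltW cX|_]; last by rewrite mulr_ge0 ?invr_ge0// ltW.
by rewrite mulrC ler_pdivlMr// mul1r.
Qed.

Lemma trace_even_ge0 n (A : 'M[R]_n) k : A^T = A -> 0 <= \tr (A ^+ k.*2).
Proof.
move=> sA; rewrite -addnn exprD -mulmxE -[X in X *m _]trmxK trmxX sA.
exact: mxinner_ge0.
Qed.

Lemma dilation_trace_ge0 n p (A : 'M[R]_(n, p)) k : 0 <= \tr (dilation A ^+ k.*2).
Proof. exact/trace_even_ge0/dilation_sym. Qed.

Definition signr (b : bool) : R := if b then 1 else -1.

(** A Khintchine inequality.  For signs the conditional variance is
    deterministic: its diagonal entries are the total squared weights of the rows
    and of the columns, bounded by [w]. *)
Lemma rademacher_moment n p N (f : 'I_N -> 'I_n * 'I_p) (v : 'I_N -> R) w k :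
  0 <= w -> (forall i, \sum_t (touches (f t) i)%:R * v t ^+ 2 <= w) ->
  \sum_(e : {ffun 'I_N -> bool})
    \tr (dilation (\sum_t (signr (e t) * v t) *: cell (f t)) ^+ k.+1.*2) <=
  (n + p)%:R * (2 * k.+1%:R * w) ^+ k.+1 * 2 ^+ N.
Proof.
move=> w0 Hw; pose Z t b := signr b *: (v t *: dilation (cell (f t)) : 'M[R]_(n + p)).
have Zsym t b : (Z t b)^T = Z t b.
  by rewrite /Z !(linearZ, dilation_sym)/= linearZ/= dilation_sym.
have Zcen t : \sum_b Z t b = 0.
  by rewrite big_bool /= /Z -scalerDl /signr subrr scale0r.
have ssE (e : {ffun 'I_N -> bool}) : dilation (\sum_t (signr (e t) * v t) *: cell (f t)) = sample_sum Z e.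
  by rewrite dilation_sum; apply: eq_bigr => t _; rewrite dilationZ /Z scalerA.
under eq_bigr do rewrite ssE.
have := @matrix_moment R bool N (n + p) Z Zsym Zcen (fun=> w).
rewrite card_bool => /(_ isT (fun=> w0)) H; apply: le_trans (H _ k) _.
  move=> e x.
  have diff t b : mxinner (x *m (Z t (e t) - Z t b)) (x *m (Z t (e t) - Z t b)) =
      (e t != b)%:R * (4 * (v t ^+ 2 *
       mxinner (x *m dilation (cell (f t))) (x *m dilation (cell (f t))))).
    rewrite /Z -scalerBl -!scalemxAr !mxinnerL /signr.
    by case: (e t); case: b => /=; ring.
  have -> : \sum_t \sum_b mxinner (x *m (Z t (e t) - Z t b)) (x *m (Z t (e t) - Z t b))
      = 4 * \sum_i (\sum_t (touches (f t) i)%:R * v t ^+ 2) * x 0 i ^+ 2.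
    under [in RHS]eq_bigr do rewrite mulr_suml.
    rewrite [X in _ = 4 * X]exchange_big/= mulr_sumr; apply: eq_bigr => t _.
    have -> : \sum_i (touches (f t) i)%:R * v t ^+ 2 * x 0 i ^+ 2 =
        v t ^+ 2 * mxinner (x *m dilation (cell (f t))) (x *m dilation (cell (f t))).
      by rewrite mxinner_dilation_cell mulr_sumr; apply: eq_bigr => i _; ring.
    under eq_bigr do rewrite diff.
    by rewrite big_bool /=; case: (e t) => /=; rewrite ?mul1r ?mul0r ?addr0 ?add0r.
  rewrite (_ : 2 * 2%:R = 4)// -?mulrA; last by rewrite -natrM.
  rewrite ler_wpM2l// mxinnerE big_ord1 mulr_sumr; apply: ler_sum => i _.
  by rewrite -expr2 ler_wpM2r ?sqr_ge0.
rewrite sumr_const card_ffun card_bool card_ord -[X in _ * X]mulr_natr natrX mulrA.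
rewrite ler_wpM2r ?exprn_ge0// -mulrA -exprMn ler_wpM2l//.
rewrite lerXn2r ?nnegrE ?mulr_ge0// ler_wpM2r// -natrM ler_nat.
by rewrite mul2n doubleS.
Qed.

End rademacher.

(** * Gaussian estimates *)

Section gaussian.
Context {R : realType}.
Notation mu := (@lebesgue_measure R).

Lemma normal_pdf_even (s x : R) : s != 0 -> normal_pdf 0 s (- x) = normal_pdf 0 s x.
Proof. by move=> s0; rewrite normal_pdfE//= /normal_fun !subr0 sqrrN. Qed.

Lemma normal_prob_symmetric (s : R) (A : set R) : s != 0 -> measurable A ->
  normal_prob 0 s (-%R @^-1` A) = normal_prob 0 s A.
Proof.
move=> s0 mA; rewrite /normal_prob.
transitivity (\int[pushforward mu (-%R : _ -> measurableTypeR R)]_(x in A)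
    (normal_pdf 0 s x)%:E)%E.
  rewrite ge0_integral_pushforward//=.
  - by apply: eq_integral => x _; rewrite normal_pdf_even.
  - by apply/measurable_EFinP; apply: measurable_funTS; exact: measurable_normal_pdf.
  - by move=> x _; rewrite lee_fin normal_pdf_ge0.
by apply: eq_measure_integral => //= B mB BA; exact: lebesgue_measureN.
Qed.

(** Tilting: [exp (x^2 / (4 s^2))] times the centered normal density of
    variance [s^2] is [sqrt 2] times that of variance [2 s^2]. *)
Lemma normal_prob_tilt (s c : R) (A : set R) : 0 < s -> measurable A ->
  (forall x, A x -> c <= x ^+ 2 / s ^+ 2) ->
  ((expR (c / 4))%:E * normal_prob 0 s A <=
   (Num.sqrt 2)%:E * normal_prob 0 (Num.sqrt 2 * s)%R A)%E.
Proof.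
move=> s0 mA Ac; rewrite /normal_prob.
have s2 : 0 < Num.sqrt 2 * s by rewrite mulr_gt0// sqrtr_gt0.
have mpdf r : measurable_fun A (fun x => (normal_pdf 0 r x)%:E).
  by apply/measurable_EFinP; apply: measurable_funTS; exact: measurable_normal_pdf.
have pdf0 r x : A x -> (0 <= (normal_pdf 0 r x)%:E)%E.
  by rewrite lee_fin normal_pdf_ge0.
rewrite -!ge0_integralZl_EFin ?expR_ge0 ?sqrtr_ge0//.
2,4: by move=> x; exact: pdf0.
2,3: exact: mpdf.
apply: ge0_le_integral => //.
  by move=> x Ax; apply: mule_ge0; [rewrite lee_fin expR_ge0|exact: pdf0].
1,2: by apply: measurable_funeM; exact: mpdf.
move=> x Ax; have cx := Ac _ Ax; rewrite -!EFinM lee_fin !normal_pdfE ?gt_eqF//.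
rewrite /normal_fun /normal_peak !subr0.
have -> : (Num.sqrt ((Num.sqrt 2 * s) ^+ 2 * pi *+ 2))^-1 =
    (Num.sqrt 2)^-1 * (Num.sqrt (s ^+ 2 * pi *+ 2))^-1.
  rewrite -invfM -sqrtrM//; congr (Num.sqrt _)^-1.
  by rewrite exprMn sqr_sqrtr//; ring.
rewrite !mulrA mulfV ?mul1r ?gt_eqF ?sqrtr_gt0// [leLHS]mulrAC -expRD [leLHS]mulrC.
rewrite ler_wpM2l ?invr_ge0 ?sqrtr_ge0// ler_expR.
rewrite exprMn sqr_sqrtr//.
have -> : - x ^+ 2 / (2 * s ^+ 2 *+ 2) = - x ^+ 2 / (s ^+ 2 *+ 2) + x ^+ 2 / s ^+ 2 / 4.
  by field; rewrite gt_eqF.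
by rewrite addrC lerD2l ler_wpM2r.
Qed.
End gaussian.

(** * Finite families of events *)

Section finite_valued.
Context d (T : measurableType d) (R : realType).

(** Total probability over the fibres of a function with finitely many
    values. *)
Lemma measure_fibers (m : {measure set T -> \bar R}) (I : finType) (Z : T -> I)
    (A : set T) : measurable A -> (forall i, measurable (Z @^-1` [set i])) ->
  (m A = \sum_i m (A `&` Z @^-1` [set i]))%E.
Proof.
move=> mA mZ; pose F (i : I) := A `&` Z @^-1` [set i].
have mF i : measurable (F i) by exact: measurableI.
have AE : A = \big[setU/set0]_(k < #|I|) F (enum_val k).
  rewrite -bigcup_seq; apply/seteqP; split => [x Ax|x [k _ []]//].
  exists (enum_rank (Z x)); first by rewrite /= mem_index_enum.
  by split => //=; rewrite enum_rankK.
rewrite {1}AE measure_semi_additive_ord//.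
- by rewrite -(big_enum_val (fun i => m (F i))) /=; apply: eq_bigl => i; rewrite inE.
- apply/trivIsetP => i j _ _ ij; apply/seteqP; split => // x [[_ /= Zi] [_ /= Zj]].
  by move/eqP: ij; apply; apply: enum_val_inj; rewrite -Zi -Zj.
- by rewrite -AE.
Qed.

Variable P : probability T R.

(** Probabilities as real numbers, for use with real-valued finite sums. *)
Definition pr (A : set T) : R := fine (P A).

Lemma prE A : measurable A -> P A = (pr A)%:E.
Proof. by move=> mA; rewrite fineK// fin_num_measure. Qed.

Lemma pr_ge0 A : 0 <= pr A.
Proof. exact: fine_ge0. Qed.

Lemma pr_le A B : measurable A -> measurable B -> A `<=` B -> pr A <= pr B.
Proof.
move=> mA mB AB; rewrite -lee_fin -!prE//.
by apply: le_measure => //; rewrite inE.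
Qed.

Lemma pr_fibers (I : finType) (Z : T -> I) (A : set T) : measurable A ->
  (forall i, measurable (Z @^-1` [set i])) ->
  pr A = \sum_i pr (A `&` Z @^-1` [set i]).
Proof.
move=> mA mZ; apply: EFin_inj; rewrite -prE// (measure_fibers _ mA mZ) -sumEFin.
by apply: eq_bigr => i _; exact/prE/measurableI.
Qed.

Lemma prT : pr setT = 1.
Proof. by rewrite /pr probability_setT. Qed.

Lemma prC A : measurable A -> pr (~` A) = 1 - pr A.
Proof. by move=> mA; rewrite /pr probability_setC// fineB// fin_num_measure. Qed.

Lemma prDI A B : measurable A -> measurable B ->
  pr A = pr (A `&` B) + pr (A `&` ~` B).
Proof.
move=> mA mB; pose Z x := `[< B x >].
have ZB b : Z @^-1` [set b] = if b then B else ~` B.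
  case: b; apply/seteqP; split => x /=; rewrite /Z.
  - by move/asboolP.
  - by move=> Bx; apply/asboolP.
  - by move/negbT/asboolPn.
  - by move=> nBx; apply/negbTE/asboolPn.
rewrite (@pr_fibers _ Z)// => [|b]; last by rewrite ZB; case: b => //; exact: measurableC.
by rewrite big_bool /= !ZB.
Qed.

(** If no outcome belongs to more than [c] of the events, their probabilities add
    up to at most [c]; this replaces the integral of a sum of indicators. *)
Lemma sum_pr_le (I : finType) (A : I -> set T) (c : R) :
  (forall i, measurable (A i)) ->
  (forall x, \sum_i (`[< A i x >])%:R <= c) -> \sum_i pr (A i) <= c.
Proof.
move=> mA Ac; pose Z x : {ffun I -> bool} := [ffun i => `[< A i x >]].
have mZ z : measurable (Z @^-1` [set z]).
  have -> : Z @^-1` [set z] = \big[setI/setT]_i (if z i then A i else ~` A i).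
    rewrite -bigcap_seq; apply/seteqP; split => [x /= <- i _|x H].
      by rewrite /Z ffunE; case: asboolP.
    apply/ffunP => i; rewrite ffunE; have := H i (mem_index_enum _).
    by case: (z i) => AP; [exact/asboolP|exact/negbTE/asboolPn].
  by apply: bigsetI_measurable => i _; case: (z i) => //; exact: measurableC.
have c_le z : Z @^-1` [set z] !=set0 -> \sum_i (z i)%:R <= c.
  move=> [x /= <-]; apply: le_trans (Ac x); apply: ler_sum => i _.
  by rewrite /Z ffunE.
under eq_bigr => i _ do rewrite (pr_fibers (mA i) mZ).
rewrite exchange_big/= -[leRHS]mulr1 -prT (pr_fibers measurableT mZ) mulr_sumr.
apply: ler_sum => z _; rewrite setTI.
have [->|z0] := eqVneq (Z @^-1` [set z]) set0.
  by under eq_bigr do rewrite setI0; rewrite /pr measure0/= mulr0 big1.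
apply: (@le_trans _ _ (\sum_i (z i)%:R * pr (Z @^-1` [set z]))); last first.
  by rewrite -mulr_suml ler_wpM2r ?pr_ge0// c_le//; exact/set0P.
apply: ler_sum => i _; case zi : (z i).
  by rewrite mul1r; apply: pr_le => //; exact: measurableI.
rewrite mul0r (_ : _ `&` _ = set0) ?/pr ?measure0//.
apply/seteqP; split => // x [Aix /= Zx]; move: zi; rewrite -Zx ffunE.
by move/asboolPn.
Qed.

End finite_valued.

(** * Discretized squared Gaussian *)

Section level.
Context {R : realType} (s : R) (T : nat).
Hypothesis s_gt0 : 0 < s.

(** The integer just above [x^2 / s^2], capped at [T].  Having finitely many
    values, it reduces Chernoff's method for independent Gaussians to finite
    sums. *)
Definition level (x : R) : nat := minn (Num.truncn (x ^+ 2 / s ^+ 2)).+1 T.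

Let z_ge0 (x : R) : 0 <= x ^+ 2 / s ^+ 2.
Proof. by rewrite divr_ge0 ?sqr_ge0. Qed.

Lemma ltn_level x : (level x < T.+1)%N.
Proof. by rewrite ltnS geq_minr. Qed.

Definition level_ord (x : R) : 'I_T.+1 := Ordinal (ltn_level x).

Lemma level_ge x : (level x)%:R - 1 <= x ^+ 2 / s ^+ 2.
Proof.
have /andP[H _] := truncn_itv (z_ge0 x).
apply: le_trans H; rewrite lerBlDr natr1 ler_nat; exact: geq_minl.
Qed.

Lemma level_gt x : (level x < T)%N -> x ^+ 2 / s ^+ 2 <= (level x)%:R.
Proof.
rewrite /level; have [TT _|tT] := leqP (Num.truncn (x ^+ 2 / s ^+ 2)).+1 T.
  by apply/ltW/truncnS_gt.
by rewrite ltnn.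
Qed.

Let measurable_level_ge j : measurable [set x : R | (j <= level x)%N].
Proof.
case: j => [|j]; first by rewrite (_ : [set _ | _] = setT)//; apply/seteqP.
have [jT|jT] := leqP j.+1 T; last first.
  rewrite (_ : [set _ | _] = set0)//; apply/seteqP; split => // x /=.
  by rewrite leq_min leqNgt ltnS [(_ <= T)%N]leqNgt jT andbF.
rewrite (_ : [set _ | _] = [set x | j%:R <= x ^+ 2 / s ^+ 2]); last first.
  by apply/seteqP; split => x /=; rewrite leq_min jT andbT ltnS truncn_ge_nat.
have -> : [set x | j%:R <= x ^+ 2 / s ^+ 2] =
    (fun x : R => x ^+ 2 / s ^+ 2) @^-1` `[j%:R, +oo[.
  by apply/seteqP; split => x /=; rewrite in_itv/= andbT.
rewrite -[X in measurable X]setTI; exact: measurable_funM.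
Qed.

Lemma measurable_level j : measurable (level_ord @^-1` [set j]).
Proof.
have -> : level_ord @^-1` [set j] =
    [set x | (j <= level x)%N] `\` [set x | (j.+1 <= level x)%N].
  apply/seteqP; split => x /=.
    by move=> <- /=; rewrite leqnn ltnn.
  by move=> [jx /negP]; rewrite -leqNgt => xj; apply/val_inj/anti_leq; rewrite /= jx xj.
exact: measurableD.
Qed.

Let q j : R := fine (normal_prob 0 s (level_ord @^-1` [set j])).

Lemma sum_level_prob : \sum_j q j = 1.
Proof.
have := @pr_fibers _ _ R (normal_prob 0 s) _ level_ord setT measurableT measurable_level.
by rewrite prT => ->; apply: eq_bigr => j _; rewrite setTI.
Qed.

(** By [normal_prob_tilt] each term is at most [exp (1/4) sqrt 2] times the
    probability of the same level under a wider Gaussian, and these sum to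
    one. *)
Lemma level_mgf : \sum_j q j * expR (j%:R / 4) <= expR (4^-1) * Num.sqrt 2.
Proof.
pose q2 (j : 'I_T.+1) : R := fine (normal_prob 0 (Num.sqrt 2 * s) (level_ord @^-1` [set j])).
have q21 : \sum_j q2 j = 1.
  have := @pr_fibers _ _ R (normal_prob 0 (Num.sqrt 2 * s)) _ level_ord setT
    measurableT measurable_level.
  by rewrite prT => ->; apply: eq_bigr => j _; rewrite setTI.
rewrite -[leRHS]mulr1 -[X in _ <= _ * X]q21 mulr_sumr; apply: ler_sum => j _.
have -> : expR (j%:R / 4) = expR 4^-1 * expR ((j%:R - 1) / 4) :> R.
  by rewrite -expRD; congr expR; field.
rewrite mulrCA -mulrA ler_wpM2l ?expR_ge0// mulrC -lee_fin.
have := @normal_prob_tilt R s (j%:R - 1) _ s_gt0 (measurable_level j).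
rewrite !EFinM !fineK ?fin_num_measure//; try exact: measurable_level.
by apply => x <-; exact: level_ge.
Qed.
End level.

(** * Symmetry of the noise *)

Section measurable_matrix.
Context d (T : measurableType d) (R : realType).

Definition measurable_entries m n (A : T -> 'M[R]_(m, n)) :=
  forall i j, measurable_fun setT (fun x => A x i j).

Lemma measurable_entries_mul m n p (A : T -> 'M[R]_(m, n)) (B : T -> 'M[R]_(n, p)) :
  measurable_entries A -> measurable_entries B ->
  measurable_entries (fun x => A x *m B x).
Proof.
move=> mA mB i j.
have -> : (fun x => (A x *m B x) i j) = (fun x => \sum_k A x i k * B x k j).
  by apply/funext => x; rewrite mxE.
by apply: measurable_sum => k; apply: measurable_funM.
Qed.

Lemma measurable_trace_pow n (A : T -> 'M[R]_n) k : measurable_entries A ->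
  measurable_fun setT (fun x => \tr (A x ^+ k)).
Proof.
move=> mA; have mAk : measurable_entries (fun x => A x ^+ k).
  elim: k => [|k IH]; first by move=> i j; exact: measurable_cst.
  by under eq_fun do rewrite exprS; exact: (measurable_entries_mul mA IH).
by rewrite /mxtrace; apply: measurable_sum => i; exact: mAk.
Qed.

Lemma measurable_entries_dilation m n (A : T -> 'M[R]_(m, n)) :
  measurable_entries A -> measurable_entries (fun x => dilation (A x)).
Proof.
move=> mA i j; case: (split_ordP i) => i' ->; case: (split_ordP j) => j' ->.
- by under eq_fun do rewrite /dilation block_mxEul mxE; exact: measurable_cst.
- by under eq_fun do rewrite /dilation block_mxEur; exact: mA.
- by under eq_fun do rewrite /dilation block_mxEdl mxE; exact: mA.
- by under eq_fun do rewrite /dilation block_mxEdr mxE; exact: measurable_cst.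
Qed.

End measurable_matrix.

Section independence.
Context d (Omega : measurableType d) (R : realType) (P : probability Omega R).

Lemma indep_pr d' (T : measurableType d') N (Z : 'I_N -> {RV P >-> T})
    (B : 'I_N -> set T) : mutually_independent Z ->
  (forall t, measurable (B t)) ->
  measurable (\bigcap_t (Z t @^-1` B t)) /\
  pr P (\bigcap_t (Z t @^-1` B t)) = \prod_t pr P (Z t @^-1` B t).
Proof.
move=> indep mB.
have mZ t : measurable (Z t @^-1` B t).
  by rewrite -[X in measurable X]setTI; exact: measurable_funP.
have mcap : measurable (\bigcap_t (Z t @^-1` B t)).
  exact: fin_bigcap_measurable.
split=> //; apply: EFin_inj; rewrite -prE// -prodEFin.
have := indep [set: 'I_N]%SET B mB.
rewrite (_ : \bigcap_(t in _) _ = \bigcap_t (Z t @^-1` B t)); last first.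
  by congr bigcap; apply/seteqP; split => t //= _; rewrite inE.
move=> ->; apply: eq_big => [t|t _]; first by rewrite inE.
exact: prE.
Qed.

Context (N : nat) (xi : 'I_N -> {RV P >-> R}) (sigma : R).
Hypothesis sigma_gt0 : 0 < sigma.
Hypothesis xi_indep : mutually_independent xi.
Hypothesis xi_normal : forall t B, measurable B ->
  distribution P (xi t) B = normal_prob 0 sigma B.

Let xi_pr t B : measurable B -> pr P (xi t @^-1` B) = fine (normal_prob 0 sigma B).
Proof. by move=> mB; rewrite -(xi_normal t mB). Qed.

Definition signed_tuple (e : {ffun 'I_N -> bool}) (w : Omega) : N.-tuple R :=
  [tuple signr (e t) * xi t w | t < N].

Let measurable_signed_tuple e : measurable_fun setT (signed_tuple e).
Proof.
apply/measurable_fun_tnthP => t.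
have -> : tnth (T:=R) ^~ t \o signed_tuple e = (fun w => signr (e t) * xi t w).
  by apply/funext => w /=; rewrite tnth_mktuple.
by apply: measurable_funM.
Qed.

(** The law of the noise vector is determined by rectangles, and on a rectangle
    a change of sign only reflects some factors. *)
Lemma sign_flip (e : {ffun 'I_N -> bool}) (Y : set (N.-tuple R)) : measurable Y ->
  P (signed_tuple e @^-1` Y) = P (signed_tuple [ffun=> true] @^-1` Y).
Proof.
move=> mY; pose e1 : {ffun 'I_N -> bool} := [ffun=> true].
pose G := [set A : set (N.-tuple R) | exists B : 'I_N -> set R,
  (forall t, measurable (B t)) /\ A = [set v | forall t, B t (tnth v t)]].
have Gm : G `<=` measurable.
  move=> _ [B [mB ->]].
  have -> : [set v : N.-tuple R | forall t, B t (tnth v t)] =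
      \bigcap_t ((fun v => tnth v t) @^-1` B t).
    by apply/seteqP; split => [v H t _|v H t]; [exact: H|exact: H].
  apply: fin_bigcap_measurable => // t _; rewrite -[X in measurable X]setTI.
  exact: measurable_tnth.
have rect_law e' B : (forall t, measurable (B t)) ->
    P (signed_tuple e' @^-1` [set v | forall t, B t (tnth v t)]) =
    (\prod_t normal_prob 0 sigma (B t))%E.
  move=> mB; pose B' t := if e' t then B t else -%R @^-1` B t.
  have mB' t : measurable (B' t).
    rewrite /B'; case: (e' t) => //; rewrite -[X in measurable X]setTI.
    exact: oppr_measurable.
  have -> : signed_tuple e' @^-1` [set v | forall t, B t (tnth v t)] =
      \bigcap_t (xi t @^-1` B' t).
    apply/seteqP; split => [w /= H t _|w H /= t].
      have := H t; rewrite tnth_mktuple /B' /signr; case: (e' t); rewrite ?mul1r// mulN1r.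
      by [].
    have := H t I; rewrite tnth_mktuple /B' /signr; case: (e' t); rewrite ?mul1r// mulN1r.
    by [].
  have [mcap capE] := indep_pr xi_indep mB'.
  rewrite prE// capE -prodEFin; apply: eq_bigr => t _.
  rewrite (xi_pr t (mB' t)) fineK; last by apply: fin_num_measure; exact: mB'.
  rewrite /B'; case: (e' t) => //.
  by rewrite normal_prob_symmetric// gt_eqF.
pose V e' : {mfun Omega >-> N.-tuple R} :=
  mfun_Sub (mem_set (measurable_signed_tuple e')).
have GT : G setT.
  exists (fun=> setT); split=> [u|]; first exact: measurableT.
  by apply/seteqP; split.
have GI : setI_closed G.
  move=> _ _ [A [mA ->]] [B [mB ->]]; exists (fun t => A t `&` B t).
  split=> [u|]; first exact: measurableI.
  apply/seteqP; split => [v [HA HB] u|v H]; first by split; [exact: HA|exact: HB].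
  by split => u; have [] := H u.
have sG : <<s G >> Y.
  apply: smallest_sub mY; first exact: smallest_sigma_algebra.
  rewrite -bigcup_seq => A [t _ [B mB <-]]; apply: sub_sigma_algebra.
  exists (fun u => if u == t then B else setT); split=> [u|].
    by case: ifP => // _; exact: measurableT.
  rewrite setTI; apply/seteqP; split => [v /= Bv u|v /= /(_ t)]; last by rewrite eqxx.
  by case: eqP => // ->.
have cover : \bigcup_(k : nat) (fun=> setT) k = [set: N.-tuple R].
  by apply/seteqP; split => // v _; exists 0%N.
have eG A : G A -> distribution P (V e) A = distribution P (V e1) A.
  by move=> [B [mB ->]]; exact: etrans (rect_law e B mB) (esym (rect_law e1 B mB)).
have fin (k : nat) : (distribution P (V e) setT < +oo)%E.
  by rewrite probability_setT ltry.
exact: (@g_sigma_algebra_measure_unique _ R _ G Gm (fun=> setT) (fun=> GT)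
  cover (distribution P (V e)) (distribution P (V e1)) GI eG fin Y sG).
Qed.
End independence.

(** * Tail bounds for the noise matrix *)

Section noise.
Context d (Omega : measurableType d) (R : realType) (P : probability Omega R).
Context (N : nat) (xi : 'I_N -> {RV P >-> R}) (sigma : R).
Hypothesis sigma_gt0 : 0 < sigma.
Hypothesis xi_indep : mutually_independent xi.
Hypothesis xi_normal : forall t B, measurable B ->
  distribution P (xi t) B = normal_prob 0 sigma B.
Context (n p : nat).
Hypothesis n_gt0 : (0 < n)%N.
Hypothesis p_gt0 : (0 < p)%N.
Local Notation sample := {ffun 'I_N -> 'I_n * 'I_p}.

Definition bounded_weights (f : sample) (W : R) : set Omega :=
  [set w | forall i, \sum_t (touches (f t) i)%:R * xi t w ^+ 2 <= W].

Definition noise_trace (f : sample) k (w : Omega) : R :=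
  \tr (dilation (\sum_t xi t w *: cell (f t)) ^+ k.*2).

Lemma measurable_weights m (f : sample) (i : 'I_(n + p)) dT (T : measurableType dT)
    (v : T -> 'I_N -> R) : (forall t, measurable_fun setT (v ^~ t)) ->
  measurable_fun setT (fun w => \sum_t (touches (f t) i)%:R * v w t ^+ m).
Proof.
move=> mv; apply: measurable_sum => t; apply: measurable_funM => //.
exact: measurable_funX.
Qed.

Lemma measurable_noise_trace (f : sample) k dT (T : measurableType dT)
    (v : T -> 'I_N -> R) : (forall t, measurable_fun setT (v ^~ t)) ->
  measurable_fun setT (fun w =>
    \tr (dilation (\sum_t v w t *: cell (f t) : 'M[R]_(n, p)) ^+ k)).
Proof.
move=> mv; apply: measurable_trace_pow; apply: measurable_entries_dilation => i j.
under eq_fun do rewrite summxE; apply: measurable_sum => t.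
under eq_fun do rewrite mxE; exact: measurable_funM.
Qed.

Let measurable_le dT (T : measurableType dT) (g : T -> R) c :
  measurable_fun setT g -> measurable [set w | g w <= c].
Proof.
move=> mg; have -> : [set w | g w <= c] = g @^-1` `]-oo, c].
  by apply/seteqP; split => x /=; rewrite in_itv.
by rewrite -[X in measurable X]setTI; exact: mg.
Qed.

Let measurable_bounded (f : sample) W dT (T : measurableType dT) (v : T -> 'I_N -> R) :
  (forall t, measurable_fun setT (v ^~ t)) ->
  measurable [set w | forall i : 'I_(n + p), \sum_t (touches (f t) i)%:R * v w t ^+ 2 <= W].
Proof.
move=> mv; have -> : [set w | forall i : 'I_(n + p), \sum_t (touches (f t) i)%:R * v w t ^+ 2 <= W]
   = \bigcap_i [set w | \sum_t (touches (f t) (i : 'I_(n + p)))%:R * v w t ^+ 2 <= W].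
  by apply/seteqP; split => [w H i _|w H i]; exact: H.
apply: fin_bigcap_measurable => // i _; apply: measurable_le.
exact: measurable_weights.
Qed.

Lemma measurable_bounded_weights f W : measurable (bounded_weights f W).
Proof. by apply: measurable_bounded => t; exact: measurable_funP. Qed.

Lemma measurable_small_noise f k c : measurable [set w | noise_trace f k w <= c].
Proof.
by apply: measurable_le; apply: measurable_noise_trace => t; exact: measurable_funP.
Qed.

(** By [sign_flip] the event has the same probability after any change of signs,
    and bounded weights are not affected by signs.  So it suffices to bound, for
    each outcome, the proportion of signs that make the trace large: this is
    Markov's inequality for [rademacher_moment]. *)
Lemma noise_tail (f : sample) (W c : R) k : 0 <= W -> 0 < c ->
  pr P (~` [set w | noise_trace f k.+1 w <= c] `&` bounded_weights f W) <=
  c^-1 * ((n + p)%:R * (2 * k.+1%:R * W) ^+ k.+1).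
Proof.
move=> W0 c0.
pose trv (v : 'I_N -> R) : R := \tr (dilation (\sum_t v t *: cell (f t)) ^+ k.+1.*2).
pose Y : set (N.-tuple R) := ~` [set v | trv (tnth v) <= c] `&`
  [set v | forall i : 'I_(n + p), \sum_t (touches (f t) i)%:R * tnth v t ^+ 2 <= W].
have mtnth t : measurable_fun setT (fun v : N.-tuple R => tnth v t).
  exact: measurable_tnth.
have mY : measurable Y.
  apply: measurableI; last exact: measurable_bounded.
  by apply/measurableC/measurable_le/measurable_noise_trace.
have mV e : measurable (signed_tuple xi e @^-1` Y).
  rewrite -[X in measurable X]setTI; apply: (_ : measurable_fun setT _) => //.
  apply/measurable_fun_tnthP => t.
  have -> : tnth (T:=R) ^~ t \o signed_tuple xi e = (fun w => signr (e t) * xi t w).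
    by apply/funext => w /=; rewrite tnth_mktuple.
  by apply: measurable_funM.
have -> : ~` [set w | noise_trace f k.+1 w <= c] `&` bounded_weights f W =
    signed_tuple xi [ffun=> true] @^-1` Y.
  have E w : tnth (signed_tuple xi [ffun=> true] w) = xi ^~ w.
    by apply/funext => t; rewrite tnth_mktuple ffunE /signr mul1r.
  by apply/seteqP; split => w /=; rewrite /Y /= E.
have N0 : 0 < 2 ^+ N :> R by rewrite exprn_gt0.
rewrite -(ler_pM2l N0).
have -> : 2 ^+ N * pr P (signed_tuple xi [ffun=> true] @^-1` Y) =
    \sum_(e : {ffun 'I_N -> bool}) pr P (signed_tuple xi e @^-1` Y).
  rewrite (eq_bigr (fun=> pr P (signed_tuple xi [ffun=> true] @^-1` Y))) => [|e _].
    by rewrite sumr_const card_ffun card_bool card_ord -[RHS]mulr_natl natrX.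
  by rewrite /pr (sign_flip sigma_gt0 xi_indep xi_normal).
apply: sum_pr_le => // w.
have [Gw|nGw] := pselect (bounded_weights f W w); last first.
  rewrite big1 => [|e _]; first by rewrite mulr_ge0 ?(ltW N0)// mulr_ge0 ?invr_ge0 ?(ltW c0)// mulr_ge0// exprn_ge0// mulr_ge0.
  rewrite (_ : `[< _ >] = false)//; apply/negbTE/asboolPn => -[_ /= H]; apply: nGw => i.
  apply: le_trans (H i); rewrite le_eqVlt; apply/orP; left; apply/eqP.
  by apply: eq_bigr => t _; rewrite tnth_mktuple exprMn /signr; case: (e t); rewrite ?expr1n ?sqrrN ?expr1n mul1r.
have := @rademacher_moment R n p N f (xi ^~ w) W k W0 Gw.
set X := fun e : {ffun 'I_N -> bool} => \tr (dilation (\sum_t (signr (e t) * xi t w) *: cell (f t)) ^+ k.+1.*2).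
move=> H; have := @finite_markov R _ X c c0 (fun e => dilation_trace_ge0 _ _).
have ci : 0 <= c^-1 by rewrite invr_ge0 ltW.
move=> /le_trans /(_ (ler_wpM2l ci H)).
have -> : c^-1 * ((n + p)%:R * (2 * k.+1%:R * W) ^+ k.+1 * 2 ^+ N) =
  2 ^+ N * (c^-1 * ((n + p)%:R * (2 * k.+1%:R * W) ^+ k.+1)) by ring.
apply: le_trans; apply: ler_sum => e _; rewrite ler_nat.
case: asboolP => // -[/= Hc _]; rewrite lt0b ltNge; apply/negP => Xc; apply: Hc.
rewrite /trv (eq_bigr (fun t => (signr (e t) * xi t w) *: cell (f t))) => [//|t _].
by rewrite tnth_mktuple.
Qed.

Local Notation L := (N%:R / (minn n p)%:R : R).

(** Chernoff's method, for the positions of the cells and the levels of the noise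
    together.  Capping the levels above the threshold [c] does not change whether
    their sum exceeds [c]. *)
Lemma weights_tail (c : R) : 0 <= c ->
  \sum_(f : sample) pr P (~` bounded_weights f (sigma ^+ 2 * c)) <=
  (n * p)%:R ^+ N * ((n + p)%:R * expR (L * (expR 4^-1 * Num.sqrt 2 - 1) - c / 4)).
Proof.
move=> c0; pose T := (Num.truncn c).+1.
have cT : c < T%:R by exact: truncnS_gt.
pose q (j : 'I_T.+1) : R := fine (normal_prob 0 sigma (level_ord sigma T @^-1` [set j])).
have q0 j : 0 <= q j by exact: fine_ge0.
pose lv (w : Omega) : {ffun 'I_N -> 'I_T.+1} := [ffun t => level_ord sigma T (xi t w)].
have lvE j : lv @^-1` [set j] = \bigcap_t (xi t @^-1` (level_ord sigma T @^-1` [set j t])).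
  apply/seteqP; split => [w /= <- t _ /=|w H]; first by rewrite ffunE.
  by apply/ffunP => t; rewrite ffunE; exact: (H t I).
have lv_pr j : measurable (lv @^-1` [set j]) /\ pr P (lv @^-1` [set j]) = \prod_t q (j t).
  have [|mcap capE] := indep_pr xi_indep (B := fun t => level_ord sigma T @^-1` [set j t]).
    by move=> t; exact: measurable_level.
  rewrite lvE; split=> //; rewrite capE; apply: eq_bigr => t _.
  by rewrite /q -(xi_normal t)//; exact: measurable_level.
pose S (f : sample) (j : {ffun 'I_N -> 'I_T.+1}) i : R :=
  \sum_t (touches (f t) i)%:R * (j t)%:R.
have S_gt (f : sample) w i : sigma ^+ 2 * c < \sum_t (touches (f t) i)%:R * xi t w ^+ 2 ->
    c < S f (lv w) i.
  have s2 : 0 < sigma ^+ 2 by rewrite exprn_gt0.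
  move=> H; rewrite ltNge; apply/negP => Sc; move: H; apply/negP; rewrite -leNgt.
  apply: le_trans (_ : sigma ^+ 2 * S f (lv w) i <= _); last by rewrite ler_wpM2l// ltW.
  rewrite mulr_sumr; apply: ler_sum => t _.
  case ft: (touches (f t) i); last by rewrite !mul0r mulr0.
  rewrite !mul1r mulrC -ler_pdivrMr// ffunE; apply: level_gt => //.
  rewrite -(ltr_nat R); apply: le_lt_trans cT; apply: le_trans Sc.
  rewrite /S (bigD1 t)//= ft mul1r ffunE lerDl.
  by apply: sumr_ge0 => u _; rewrite mulr_ge0.
have fiber (f : sample) j : pr P (~` bounded_weights f (sigma ^+ 2 * c) `&` lv @^-1` [set j]) <=
    \sum_i expR (- (c / 4)) * \prod_t (q (j t) * expR ((touches (f t) i)%:R * (j t)%:R / 4)).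
  have Sexp i : \prod_t (q (j t) * expR ((touches (f t) i)%:R * (j t)%:R / 4)) =
      pr P (lv @^-1` [set j]) * expR (S f j i / 4).
    rewrite big_split /= (lv_pr j).2; congr (_ * _).
    by rewrite /S mulr_suml expR_sum.
  under eq_bigr do rewrite Sexp.
  have [[i ci]|nS] := pselect (exists i, c < S f j i); last first.
    rewrite (_ : _ `&` _ = set0); last first.
      apply/seteqP; split => // w [nb /= lvw]; apply: nb => i.
      rewrite leNgt; apply/negP => /S_gt; rewrite lvw => ci.
      by apply: nS; exists i.
    rewrite /pr measure0/=; apply: sumr_ge0 => i _.
    by rewrite !mulr_ge0 ?expR_ge0// pr_ge0.
  apply: (@le_trans _ _ (pr P (lv @^-1` [set j]))).
    apply: pr_le => //; first apply: measurableI => //.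
    - exact/measurableC/measurable_bounded_weights.
    - exact: (lv_pr j).1.
    - exact: (lv_pr j).1.
  rewrite (bigD1 i)//= -[leLHS]addr0 lerD//; last first.
    by apply: sumr_ge0 => l _; rewrite !mulr_ge0 ?expR_ge0// pr_ge0.
  rewrite mulrCA -[leLHS]mulr1 ler_wpM2l ?pr_ge0// -expRD -[leLHS]expR0 ler_expR.
  by rewrite addrC subr_ge0 ler_pM2r// ltW.
have step (f : sample) : pr P (~` bounded_weights f (sigma ^+ 2 * c)) <=
    \sum_i expR (- (c / 4)) * \prod_t \sum_j q j * expR ((touches (f t) i)%:R * j%:R / 4).
  rewrite (@pr_fibers _ _ _ P _ lv); last 2 first.
  - exact/measurableC/measurable_bounded_weights.
  - by move=> j; exact: (lv_pr j).1.
  apply: (le_trans (ler_sum _ (fun j _ => fiber f j))); rewrite exchange_big/=.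
  apply: ler_sum => i _; rewrite -mulr_sumr ler_wpM2l ?expR_ge0//.
  by rewrite -(sum_ffun_prod (fun t j => q j * expR ((touches (f t) i)%:R * j%:R / 4))).
apply: (le_trans (ler_sum _ (fun f _ => step f))); rewrite exchange_big/=.
pose B := \sum_j q j * expR (j%:R / 4).
have q1 : \sum_j q j = 1 := sum_level_prob sigma T.
have B1 : 1 <= B.
  rewrite -q1; apply: ler_sum => j _; rewrite -[leLHS]mulr1 ler_wpM2l//.
  by rewrite -expR0 ler_expR divr_ge0.
have HE (s : 'I_n * 'I_p) i : \sum_j q j * expR ((touches s i)%:R * j%:R / 4) =
    if touches s i then B else 1.
  case: ifP => _; first by apply: eq_bigr => j _; rewrite mul1r.
  by rewrite -q1; apply: eq_bigr => j _; rewrite !mul0r expR0 mulr1.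
have cd (a : R) : (n + p)%:R * a = \sum_(i < n + p) a.
  by rewrite sumr_const card_ord mulr_natl.
rewrite mulrCA cd; apply: ler_sum => i _; rewrite -mulr_sumr.
have -> : \sum_(f : sample) \prod_t \sum_j q j * expR ((touches (f t) i)%:R * j%:R / 4) =
    (\sum_(s : 'I_n * 'I_p) (if touches s i then B else 1)) ^+ N.
  rewrite -[in RHS](card_ord N) -prodr_const -sum_ffun_prod.
  by apply: eq_bigr => f _; apply: eq_bigr => t _; rewrite HE.
apply: le_trans (ler_wpM2l (expR_ge0 _) (touches_mgf N n_gt0 p_gt0 i B1)) _.
rewrite mulrCA ler_wpM2l ?exprn_ge0// -expRD ler_expR addrC lerD2r.
by rewrite ler_wpM2l ?divr_ge0// lerD2r level_mgf.
Qed.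
End noise.

(** * The good event *)

Section event.
Context d (Omega : measurableType d) (R : realType) (P : probability Omega R).
Context (n p N : nat).
Hypothesis n_gt0 : (0 < n)%N.
Hypothesis p_gt0 : (0 < p)%N.
Hypothesis N_gt0 : (0 < N)%N.
Context (X : 'I_N -> {RV P >-> borel_mx R n p}) (xi : 'I_N -> {RV P >-> R}).
Context (sigma : R).
Hypothesis sigma_gt0 : 0 < sigma.
Hypothesis X_indep : mutually_independent X.
Hypothesis X_unif : forall t A, sampling_matrices A ->
  distribution P (X t) [set A] = ((n * p)%:R^-1)%:E.
Hypothesis xi_indep : mutually_independent xi.
Hypothesis xi_normal : forall t B, measurable B ->
  distribution P (xi t) B = normal_prob 0 sigma B.
Hypothesis X_xi_indep : independent_families X xi.
Local Notation sample := {ffun 'I_N -> 'I_n * 'I_p}.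
Local Notation L := (N%:R / (minn n p)%:R : R).

Definition sampled (f : sample) : set Omega := \bigcap_t (X t @^-1` [set cell (f t)]).

Lemma measurable_mx_set1 (A : 'M[R]_(n, p)) : measurable ([set A] : set (borel_mx R n p)).
Proof.
rewrite -[X in measurable X]setCK; apply: measurableC; apply: sub_sigma_algebra.
apply: closed_openC; apply: accessible_closed_set1; apply: hausdorff_accessible.
exact: (@norm_hausdorff _ 'M[R]_(n, p)).
Qed.

Lemma sampled_pr f : measurable (sampled f) /\
  pr P (sampled f) = ((n * p)%:R^-1) ^+ N.
Proof.
have [|mcap capE] := indep_pr X_indep (B := fun t => [set cell (f t)] : set (borel_mx R n p)).
  by move=> t; exact: measurable_mx_set1.
split=> //; rewrite /sampled capE -[in RHS](card_ord N) -prodr_const.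
apply: eq_bigr => t _; rewrite /pr -[P _]/(distribution P (X t) [set cell (f t)]) X_unif//.
by exists (f t).1, (f t).2; rewrite trmx_delta mul_delta_mx.
Qed.

Lemma g_sigma_preimageP d' (T : measurableType d') m (Z : 'I_m -> Omega -> T) t B :
  measurable B -> g_sigma_preimage Z (Z t @^-1` B).
Proof.
move=> mB; apply: sub_sigma_algebra; rewrite -bigcup_seq.
by exists t => /=; [rewrite mem_index_enum|exists B; rewrite ?setTI].
Qed.

(** The noise trace is measurable for the sigma-algebra generated by [xi], and
    the sample is an event of the one generated by [X]. *)
Lemma sampled_noise_pr f k c :
  pr P (sampled f `&` [set w | noise_trace xi f k w <= c]) =
  ((n * p)%:R^-1) ^+ N * pr P [set w | noise_trace xi f k w <= c].
Proof.
have [mS <-] := sampled_pr f.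
have mN := measurable_small_noise xi f k c.
rewrite {1}/pr X_xi_indep.
- by rewrite fineM// fin_num_measure.
- pose T := g_sigma_algebraType (\big[setU/set0]_(t < N)
    preimage_set_system setT (X t : Omega -> borel_mx R n p) measurable).
  apply: (@fin_bigcap_measurable _ T) => // t _.
  by apply: g_sigma_preimageP; exact: measurable_mx_set1.
pose T := g_sigma_algebraType (\big[setU/set0]_(t < N)
  preimage_set_system setT (xi t : Omega -> R) measurable).
have mxi t : measurable_fun setT (xi t : T -> R).
  by move=> _ B mB; rewrite setTI; exact: g_sigma_preimageP.
have : measurable_fun setT (fun w : T => noise_trace xi f k w).
  exact: measurable_noise_trace.
move=> /(_ measurableT `]-oo, c]%classic); rewrite setTI.
rewrite (_ : _ @^-1` _ = [set w | noise_trace xi f k w <= c]); first by apply.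
by apply/seteqP; split => w /=; rewrite in_itv.
Qed.

Context (M : 'M[R]_(n, p)) (b : R) (k : nat) (c1 c2 cw : R).
Hypothesis b_ge0 : 0 <= b.
Hypothesis M_le : forall i j, `|M i j| <= b.
Hypothesis k_le : k.+1%:R <= 4 * L.
Hypothesis c1_gt0 : 0 < c1.
Hypothesis c2_gt0 : 0 < c2.
Hypothesis cw_ge0 : 0 <= cw.

Definition sampling_trace (f : sample) : R :=
  \tr (sample_sum (fun _ : 'I_N => centered_cell M) f ^+ k.+1.*2).

(** The two contributions to [Y - M] have small trace moments.  The samples are
    listed one by one, which makes the event measurable and its probability a
    finite sum. *)
Definition good_event : set Omega := \bigcup_(f in [set f | sampling_trace f <= c1])
  (sampled f `&` [set w | noise_trace xi f k.+1 w <= c2]).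

Lemma good_event_prob : measurable good_event /\
  1 - c1^-1 * ((n + p)%:R ^+ 2 * (16 * k.+1%:R * b ^+ 2 * L) ^+ k.+1)
    - c2^-1 * ((n + p)%:R * (2 * k.+1%:R * (sigma ^+ 2 * cw)) ^+ k.+1)
    - (n + p)%:R * expR (L * (expR 4^-1 * Num.sqrt 2 - 1) - cw / 4)
    <= pr P good_event.
Proof.
pose B f := sampled f `&` [set w | noise_trace xi f k.+1 w <= c2].
have mB f : measurable (B f).
  by apply: measurableI; [exact: (sampled_pr f).1|exact: measurable_small_noise].
have mE : measurable good_event.
  by apply: fin_bigcup_measurable => // f _; exact: mB.
split=> //.
pose A (o : option sample) : set Omega :=
  if o is Some f then (if sampling_trace f <= c1 then B f else set0) else ~` good_event.
have mA o : measurable (A o).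
  by case: o => [f|]; [rewrite /A; case: ifP|exact: measurableC].
have inj (f g : sample) w : sampled f w -> sampled g w -> f = g.
  move=> Hf Hg; apply/ffunP => t; have := Hf t I; rewrite /= (Hg t I : X t w = _).
  move/matrixP => H; have := H (f t).1 (f t).2; rewrite !mxE !eqxx /=.
  case: eqP => [e1|_] /=; last by move/eqP; rewrite ?oner_eq0 // eq_sym oner_eq0.
  case: eqP => [e2|_] /=; last by move/eqP; rewrite ?oner_eq0 // eq_sym oner_eq0.
  by move=> _; rewrite [LHS]surjective_pairing e1 e2 -surjective_pairing.
have AS f w : A (Some f) w -> sampled f w /\ good_event w.
  rewrite /A; case: ifP => [ft|_ []] Bw; split; first by case: Bw.
  by exists f.
have : \sum_o pr P (A o) <= 1.
  apply: sum_pr_le => // w.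
  have [[a Aa]|nA] := pselect (exists o, A o w); last first.
    by rewrite big1 ?ler01// => o _; rewrite (_ : `[< _ >] = false)//; apply/negbTE/asboolPn => Ao; apply: nA; exists o.
  rewrite (bigD1 a)//= big1 ?addr0; first by case: asboolP; rewrite ?ler01.
  move=> a' a'a; rewrite (_ : `[< _ >] = false)//; apply/negbTE/asboolPn => Aa'.
  move/eqP: a'a; apply.
  case: a Aa => [f|] Aa; case: a' Aa' => [g|] Aa'.
  - by congr Some; exact: inj (AS _ _ Aa').1 (AS _ _ Aa).1.
  - by case: Aa'; exact: (AS _ _ Aa).2.
  - by case: Aa; exact: (AS _ _ Aa').2.
  - by [].
rewrite (bigD1 None)//= (reindex_omap Some id) => [|[]//] /=.
rewrite (eq_bigl xpredT) => [|f]; last by rewrite eqxx.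
rewrite prC//.
have np0 : (0 : R) < (n * p)%:R by rewrite ltr0n muln_gt0 n_gt0.
set u := ((n * p)%:R^-1 : R) ^+ N.
have u0 : 0 <= u by rewrite exprn_ge0// invr_ge0.
have uN : u * (n * p)%:R ^+ N = 1 by rewrite -exprMn mulVf ?gt_eqF// expr1n.
have lower f : u * (1 - (c1 < sampling_trace f)%R%:R
    - c2^-1 * ((n + p)%:R * (2 * k.+1%:R * (sigma ^+ 2 * cw)) ^+ k.+1)
    - pr P (~` bounded_weights xi f (sigma ^+ 2 * cw))) <= pr P (A (Some f)).
  set q := c2^-1 * _; set r := pr P (~` _).
  have mG := measurable_bounded_weights xi f (sigma ^+ 2 * cw).
  have mS := measurable_small_noise xi f k.+1 c2.
  have HW : 0 <= sigma ^+ 2 * cw by apply: mulr_ge0 => //; exact: sqr_ge0.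
  have q0 : 0 <= q.
    apply: mulr_ge0; first by rewrite invr_ge0 ltW.
    by apply: mulr_ge0 => //; apply: exprn_ge0; exact: mulr_ge0.
  have r0 : 0 <= r := pr_ge0 _ _.
  rewrite /A ltNge; case: ifP => _ /=; last first.
    by rewrite /pr measure0/= -(mulr0 u) ler_wpM2l//; lra.
  rewrite sampled_noise_pr ler_wpM2l//.
  have := noise_tail sigma_gt0 xi_indep xi_normal f k HW c2_gt0.
  have := prDI P (measurableC mS) mG; rewrite prC//.
  have : pr P (~` [set w | noise_trace xi f k.+1 w <= c2] `&`
               ~` bounded_weights xi f (sigma ^+ 2 * cw)) <= r.
    apply: pr_le => //; first by apply: measurableI; exact: measurableC.
    exact: measurableC.
  by rewrite -/q; lra.
have : \sum_(f : sample) u * (1 - (c1 < sampling_trace f)%R%:R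
    - c2^-1 * ((n + p)%:R * (2 * k.+1%:R * (sigma ^+ 2 * cw)) ^+ k.+1)
    - pr P (~` bounded_weights xi f (sigma ^+ 2 * cw))) <= \sum_f pr P (A (Some f)).
  by apply: ler_sum => f _; exact: lower.
set q := c2^-1 * _.
have sum_u : \sum_(f : sample) u = 1.
  by rewrite sumr_const card_ffun card_prod !card_ord -mulr_natr natrX uN.
have -> : \sum_(f : sample) u * (1 - (c1 < sampling_trace f)%R%:R - q
      - pr P (~` bounded_weights xi f (sigma ^+ 2 * cw))) =
    1 - q - u * \sum_(f : sample) (c1 < sampling_trace f)%R%:R
      - u * \sum_(f : sample) pr P (~` bounded_weights xi f (sigma ^+ 2 * cw)).
  rewrite !mulr_sumr -[1 - q]mul1r -sum_u mulr_suml -!sumrB.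
  by apply: eq_bigr => f _; ring.
have HW := ler_wpM2l u0 (weights_tail sigma_gt0 xi_indep xi_normal n_gt0 p_gt0 cw_ge0).
rewrite [leRHS]mulrA uN mul1r in HW; move: HW.
have := sampling_moment n_gt0 p_gt0 N_gt0 b_ge0 M_le k_le.
have ci : 0 <= c1^-1 by rewrite invr_ge0 ltW.
move/(ler_wpM2l ci) => Hm.
have tr0 (f : sample) : 0 <= sampling_trace f.
  apply: trace_even_ge0; rewrite /sample_sum raddf_sum; apply: eq_bigr => t _.
  by rewrite /= /centered_cell linearB/= !linearZ/= !dilation_sym.
have := ler_wpM2l u0 (le_trans (finite_markov c1_gt0 tr0) Hm).
set Q := (n + p)%:R ^+ 2 * _.
have -> : u * (c1^-1 * (Q * (n * p)%:R ^+ N)) =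
    c1^-1 * Q * (u * (n * p)%:R ^+ N) by ring.
rewrite uN mulr1; lra.
Qed.
End event.

(** * Consequences of the good event *)

Section deterministic.
Context {R : realType}.

Lemma mxinner_cell n p (q : 'I_n * 'I_p) (M : 'M[R]_(n, p)) :
  mxinner (cell q) M = M q.1 q.2.
Proof.
rewrite mxinnerE (bigD1 q.1)//= [X in _ + X]big1 => [|i iq]; last first.
  by rewrite big1// => j _; rewrite mxE (negPf iq) mul0r.
rewrite addr0 (bigD1 q.2)//= big1 => [|j jq]; last by rewrite mxE (negPf jq) andbF mul0r.
by rewrite mxE !eqxx mul1r addr0.
Qed.

Lemma good_event_opbounded d (Omega : measurableType d) (P : probability Omega R)
    n p N (X : 'I_N -> {RV P >-> borel_mx R n p}) (xi : 'I_N -> {RV P >-> R})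
    (M : 'M[R]_(n, p)) k s1 s2 (y : 'I_N -> R) w :
  (0 < n)%N -> (0 < p)%N -> (0 < N)%N -> 0 <= s1 -> 0 <= s2 ->
  (forall t, y t = mxinner (X t w) M + xi t w) ->
  good_event X xi M k (s1 ^+ k.+1.*2) (s2 ^+ k.+1.*2) w ->
  opbounded ((n * p)%:R / N%:R * (s1 + s2))
    (((n * p)%:R / N%:R) *: (\sum_t y t *: X t w) - M).
Proof.
move=> n0 p0 N0 s10 s20 yE [f /= f1 [Xf f2]].
pose S1 := \sum_t (M (f t).1 (f t).2 *: cell (f t) - (n * p)%:R^-1 *: M).
pose S2 := \sum_t xi t w *: cell (f t) : 'M[R]_(n, p).
have S1b : opbounded s1 S1.
  apply: (@dilation_opbounded _ _ _ _ _ k) => //.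
  rewrite (_ : dilation S1 = sample_sum (fun _ => centered_cell M) f)//.
  rewrite dilation_sum; apply: eq_bigr => t _.
  by rewrite /centered_cell dilationD -scaleN1r !dilationZ scaleN1r.
have S2b : opbounded s2 S2 by exact: (@dilation_opbounded _ _ _ _ _ k).
have np0 : (n * p)%:R != 0 :> R by rewrite pnatr_eq0 -lt0n muln_gt0 n0.
have N0' : N%:R != 0 :> R by rewrite pnatr_eq0 -lt0n.
rewrite (_ : _ - M = ((n * p)%:R / N%:R) *: (S1 + S2)); last first.
  have -> : S1 + S2 = \sum_t (M (f t).1 (f t).2 *: cell (f t)) + S2 - (N%:R / (n * p)%:R) *: M.
    by rewrite /S1 sumrB sumr_const card_ord addrAC -scalerA scaler_nat.
  rewrite scalerBr scalerA [_ * (_ / _)](_ : _ = 1) ?scale1r; last by rewrite mulrC mulrA divfK// divff.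
  congr (_ *: _ - _); rewrite /S2 -big_split; apply: eq_bigr => t _ /=.
  by rewrite yE (Xf t I : X t w = _) mxinner_cell scalerDl.
by apply: opboundedZ; exact: opboundedD.
Qed.

Lemma mx_norm_ge n p (M : 'M[R]_(n, p)) i j : `|M i j| <= mx_norm M.
Proof.
rewrite mx_normE; set b := \big[_/_]_ij _.
have : (b <= b)%O by [].
by rewrite {1}/b => /bigmax_leP [_ /(_ (i, j) isT)]; rewrite -num_le.
Qed.

(** Replace each function [f_j] by a combination of the [J] functions [psi_l]: the
    matrix then factors through a space of dimension [J].  The slack [eps < r]
    avoids the question whether the infimum over the coefficients is
    attained. *)
Lemma low_rank_approximation n p K (F : set ('rV[R]_K -> R)) (M : 'M[R]_(n, p))
    C0 eps r : embeddable F M -> approximation_condition F C0 -> 0 < eps ->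
  eps < r -> exists A : 'M[R]_(n, p), (\rank A <= Jstar F C0 eps)%N /\
    forall i j, `|A i j - M i j| <= r.
Proof.
case=> f; case=> Theta; case=> Ff ME FC eps0 epsr.
have [[psi Hpsi] _] := JstarP FC eps0; have {Hpsi} [_ _ _ sup_le] := Hpsi.
set J := Jstar F C0 eps in psi sup_le *.
have ex_beta j : exists beta : 'rV[R]_J,
    forall x, `|f j x - \sum_l beta 0 l * psi l x| <= r.
  have : (approximation_error C0 psi (f j) < r%:E)%E.
    apply: le_lt_trans (_ : (eps%:E < r%:E)%E); last by rewrite lte_fin.
    apply: le_trans sup_le; apply: ereal_sup_ubound; exists (f j) => //.
  move=> /ereal_inf_lt[_ [beta _ <-] lt_r]; exists beta => x.
  rewrite -lee_fin; apply: le_trans (ltW lt_r).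
  by apply: ereal_sup_ubound; exists x.
have [beta betaP] := choice ex_beta.
exists ((\matrix_(i, l) psi l (row i Theta)) *m (\matrix_(l, j) beta j 0 l)).
split; first by rewrite (leq_trans (mxrankM_maxl _ _))// rank_leq_col.
move=> i j; rewrite distrC ME; apply: le_trans (betaP j (row i Theta)).
rewrite mxE le_eqVlt; apply/orP; left; apply/eqP; congr (`|_ - _|).
by apply: eq_bigr => l _; rewrite !mxE mulrC.
Qed.

Lemma mxinner_entries_le n p (B : 'M[R]_(n, p)) r : 0 <= r ->
  (forall i j, `|B i j| <= r) -> mxinner B B <= (n * p)%:R * r ^+ 2.
Proof.
move=> r0 Br; rewrite mxinnerE.
apply: le_trans (_ : \sum_(i < n) \sum_(j < p) r ^+ 2 <= _).
  apply: ler_sum => i _; apply: ler_sum => j _.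
  by rewrite -expr2 -real_normK ?num_real// lerXn2r// nnegrE.
by rewrite !sumr_const !card_ord -mulrnA mulnC mulr_natl.
Qed.

Lemma estimator_minimizer n p N lambda (y : 'I_N -> R) (X : 'I_N -> 'M[R]_(n, p)) Mh :
  (0 < n)%N -> (0 < p)%N -> (0 < N)%N -> is_estimator lambda y X Mh ->
  let Y := ((n * p)%:R / N%:R) *: (\sum_t y t *: X t) in
  let mu := lambda * (n * p)%:R in
  forall B, mxinner Mh Mh - 2 * mxinner Y Mh + mu * nuclear_norm Mh <=
     mxinner B B - 2 * mxinner Y B + mu * nuclear_norm B.
Proof.
move=> n0 p0 N0 Hmin Y mu B.
have np0 : 0 < (n * p)%:R :> R by rewrite ltr0n muln_gt0 n0.
have N0' : N%:R != 0 :> R by rewrite pnatr_eq0 -lt0n.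
have E A : mxinner A A - 2 * mxinner Y A + mu * nuclear_norm A =
    (n * p)%:R * objective lambda y X A.
  rewrite /objective frobenius_normE /Y /mu !mxinnerZl; field.
  by rewrite N0' !pnatr_eq0 -!lt0n p0 n0.
by rewrite !E ler_pM2l// Hmin.
Qed.

End deterministic.

(** * Choice of the constants *)

Section numeric.
Context {R : realType}.

(** Through [exp (13/20) = exp (-13/160)^-8 <= (1 - 13/160)^-8 <= 2]. *)
Lemma ln2_ge : 13 / 20 <= ln 2 :> R.
Proof.
rewrite -ler_expR lnK ?posrE//.
have H : expR (- (13 / 160)) ^+ 8 * expR (13 / 20) = 1 :> R.
  by rewrite -expRM_natl -expRD -[RHS]expR0; congr expR; field.
have H1 : 1 - 13 / 160 <= expR (- (13 / 160)) :> R by exact: expR_ge1Dx.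
have : (1 - 13 / 160) ^+ 8 <= expR (- (13 / 160)) ^+ 8 :> R.
  by apply: lerXn2r => //; rewrite ?nnegrE ?expR_ge0//; lra.
have : 2^-1 <= (1 - 13 / 160) ^+ 8 :> R by lra.
have := expR_gt0 (13 / 20 : R); nra.
Qed.

Lemma scaled_pow_inv (A B D : R) k : 0 < A -> 0 < B ->
  (Num.sqrt (A * B) ^+ k.*2)^-1 * (D * A ^+ k) = D * (B ^+ k)^-1.
Proof.
move=> A0 B0; rewrite -mul2n exprM sqr_sqrtr ?mulr_ge0 ?ltW// exprMn.
by field; rewrite !expf_neq0// gt_eqF.
Qed.

Lemma three_inv_sqr_le (D : R) : 2 <= D ->
  (D ^+ 2)^-1 + (D ^+ 2)^-1 + (D ^+ 2)^-1 <= 2 * D^-1.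
Proof.
move=> D2; have D0 : 0 < D by lra.
have -> : (D ^+ 2)^-1 + (D ^+ 2)^-1 + (D ^+ 2)^-1 = 3 / D * D^-1.
  by field; exact: lt0r_neq0.
by rewrite ler_wpM2r ?invr_ge0 ?(ltW D0)// ler_pdivrMr//; lra.
Qed.

Lemma log_le_mean_visits (u l : R) : 13 / 20 <= u -> u ^+ 2 <= l -> 3 * u <= 5 * l.
Proof. nra. Qed.

End numeric.

Section probability.
Context {R : realType} (n p N : nat) (b sigma : R).
Hypothesis n_gt0 : (0 < n)%N.
Hypothesis p_gt0 : (0 < p)%N.
Hypothesis N_gt0 : (0 < N)%N.
Hypothesis b_gt0 : 0 < b.
Hypothesis sigma_gt0 : 0 < sigma.
Local Notation L := (N%:R / (minn n p)%:R : R).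
Local Notation x := (ln (n + p)%:R : R).
Hypothesis N_large : (minn n p)%:R * x ^+ 2 <= N%:R.

(** The thresholds for the two trace moments are the even powers of
    [sampling_level] and [noise_level]; compared with the moment bounds they carry
    an additional factor [exp 4] or [exp 3], whose power of order [log (n + p)]
    beats the dimension. *)
Definition tail_const : R := expR 4^-1 * Num.sqrt 2.
Definition moment_order : nat := Num.truncn x.
Definition sampling_level : R :=
  Num.sqrt (16 * moment_order.+1%:R * b ^+ 2 * L * expR 4).
Definition weight_level : R := 4 * (tail_const + 4) * L.
Definition noise_level : R :=
  Num.sqrt (2 * moment_order.+1%:R * (sigma ^+ 2 * weight_level) * expR 3).

Let min_gt0 : (0 : R) < (minn n p)%:R.
Proof. by rewrite ltr0n leq_min n_gt0. Qed.

Let L_gt0 : 0 < L.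
Proof. by rewrite divr_gt0// ltr0n. Qed.

Let x_ge : 13 / 20 <= x.
Proof.
apply: (le_trans ln2_ge); rewrite ler_ln ?posrE ?ltr0n ?addn_gt0 ?n_gt0//.
by rewrite ler_nat (leq_add n_gt0 p_gt0).
Qed.

Let L_ge : x ^+ 2 <= L.
Proof. by rewrite ler_pdivlMr// mulrC. Qed.

Let K_gt : x < moment_order.+1%:R.
Proof. exact: truncnS_gt. Qed.

Let K_le : moment_order.+1%:R <= x + 1.
Proof.
have x0 : 0 <= x by have := x_ge; lra.
by have /andP[H _] := truncn_itv x0; rewrite -natr1 lerD2r.
Qed.

Lemma moment_order_le : moment_order.+1%:R <= 4 * L.
Proof. have := L_ge; have := x_ge; have := K_le; nra. Qed.

Lemma weight_level_ge0 : 0 <= weight_level.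
Proof.
by rewrite /weight_level mulr_ge0 ?(ltW L_gt0)// mulr_ge0// addr_ge0// mulr_ge0 ?expR_ge0.
Qed.

Lemma sampling_level_gt0 : 0 < sampling_level.
Proof.
by rewrite sqrtr_gt0 mulr_gt0 ?expR_gt0// mulr_gt0// mulr_gt0 ?exprn_gt0.
Qed.

Lemma noise_level_gt0 : 0 < noise_level.
Proof.
rewrite sqrtr_gt0 mulr_gt0 ?expR_gt0// mulr_gt0// mulr_gt0 ?exprn_gt0//.
by rewrite mulr_gt0// mulr_gt0// ltr_wpDl// mulr_ge0 ?expR_ge0.
Qed.

Lemma failure_prob_le :
  (sampling_level ^+ moment_order.+1.*2)^-1 * ((n + p)%:R ^+ 2 *
    (16 * moment_order.+1%:R * b ^+ 2 * L) ^+ moment_order.+1) +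
  (noise_level ^+ moment_order.+1.*2)^-1 * ((n + p)%:R *
    (2 * moment_order.+1%:R * (sigma ^+ 2 * weight_level)) ^+ moment_order.+1) +
  (n + p)%:R * expR (L * (tail_const - 1) - weight_level / 4)
  <= 2 * (n + p)%:R^-1.
Proof.
have B0 : 0 <= tail_const by rewrite mulr_ge0 ?expR_ge0.
have w0 : 0 < weight_level by rewrite mulr_gt0// mulr_gt0// ltr_wpDl.
set D : R := (n + p)%:R.
have D2 : 2 <= D by rewrite ler_nat (leq_add n_gt0 p_gt0).
have D0 : 0 < D by lra.
have xE : expR x = D by rewrite lnK.
have decay c : expR (- (c%:R * moment_order.+1%:R)) <= (D ^+ c)^-1.
  rewrite -xE -expRM_natl -expRN ler_expR lerN2 ler_wpM2l//.
  exact: ltW.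
have powE c : (expR c%:R ^+ moment_order.+1)^-1 = expR (- (c%:R * moment_order.+1%:R)) :> R.
  by rewrite -expRM_natr -expRN.
have -> : L * (tail_const - 1) - weight_level / 4 = - (5 * L).
  by rewrite /weight_level; field; exact: lt0r_neq0.
rewrite !scaled_pow_inv ?expR_gt0//; last 2 first.
- by rewrite mulr_gt0// mulr_gt0// exprn_gt0.
- by rewrite mulr_gt0// mulr_gt0// mulr_gt0// exprn_gt0.
have H1 : D ^+ 2 * (expR 4 ^+ moment_order.+1)^-1 <= (D ^+ 2)^-1.
  rewrite (powE 4%N); apply: le_trans (ler_wpM2l (exprn_ge0 2 (ltW D0)) (decay 4%N)) _.
  by rewrite le_eqVlt; apply/orP; left; apply/eqP; field; rewrite -natrD lt0r_neq0.
have H2 : D * (expR 3 ^+ moment_order.+1)^-1 <= (D ^+ 2)^-1.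
  rewrite (powE 3%N); apply: le_trans (ler_wpM2l (ltW D0) (decay 3%N)) _.
  by rewrite le_eqVlt; apply/orP; left; apply/eqP; field; rewrite -natrD lt0r_neq0.
have H3 : D * expR (- (5 * L)) <= (D ^+ 2)^-1.
  apply: (@le_trans _ _ (D * (D ^+ 3)^-1)).
    rewrite ler_wpM2l ?(ltW D0)// -xE -expRM_natl -expRN ler_expR lerN2.
    exact: log_le_mean_visits x_ge L_ge.
  by rewrite le_eqVlt; apply/orP; left; apply/eqP; field; rewrite -natrD lt0r_neq0.
exact: le_trans (lerD (lerD H1 H2) H3) (three_inv_sqr_le D2).
Qed.

Definition sampling_const : R := Num.sqrt (16 * b ^+ 2 * expR 4).
Definition noise_const : R := Num.sqrt (8 * sigma ^+ 2 * (tail_const + 4) * expR 3).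

(** The operator bound given by the good event is at most [mu / 2] for the
    prescribed [lambda]: both sides are multiples of
    [sqrt (log (n + p) * N / min (n, p))]. *)
Lemma levels_le :
  (n * p)%:R / N%:R * (sampling_level + noise_level) <=
  2 * Num.sqrt 3 * (sampling_const + noise_const)
    * Num.sqrt (x / (N%:R * (minn n p)%:R)) * (n * p)%:R / 2.
Proof.
have B0 : 0 <= tail_const by rewrite mulr_ge0 ?expR_ge0.
have x0 : 0 <= x by have := x_ge; lra.
have N0 : (0 : R) < N%:R by rewrite ltr0n.
have KL0 : 0 <= moment_order.+1%:R * L by rewrite mulr_ge0 ?(ltW L_gt0).
have e1 : sampling_level = sampling_const * Num.sqrt (moment_order.+1%:R * L).
  rewrite /sampling_const -sqrtrM; first by congr Num.sqrt; ring.
  by rewrite mulr_ge0 ?expR_ge0// mulr_ge0 ?sqr_ge0.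
have e2 : noise_level = noise_const * Num.sqrt (moment_order.+1%:R * L).
  rewrite /noise_const -sqrtrM; first by congr Num.sqrt; rewrite /weight_level; ring.
  by rewrite mulr_ge0 ?expR_ge0// mulr_ge0 ?addr_ge0// mulr_ge0 ?sqr_ge0.
have e3 : Num.sqrt (moment_order.+1%:R * L) <=
    Num.sqrt 3 * N%:R * Num.sqrt (x / (N%:R * (minn n p)%:R)).
  have -> : Num.sqrt 3 * N%:R * Num.sqrt (x / (N%:R * (minn n p)%:R)) =
      Num.sqrt (3 * x * L).
    have NE : N%:R = Num.sqrt (N%:R ^+ 2) :> R by rewrite sqrtr_sqr gtr0_norm.
    have N2 : 0 <= 3 * N%:R ^+ 2 :> R by rewrite mulr_ge0 ?sqr_ge0.
    rewrite [X in _ * X * _]NE -(sqrtrM _ (ler0n R 3)) -(sqrtrM _ N2).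
    by congr Num.sqrt; field; rewrite !lt0r_neq0.
  by rewrite ler_wsqrtr// ler_wpM2r ?(ltW L_gt0)//; have := K_le; have := x_ge; lra.
rewrite e1 e2 -mulrDl.
set c := sampling_const + noise_const.
have c0 : 0 <= c by rewrite addr_ge0 ?sqrtr_ge0.
have := ler_wpM2l (mulr_ge0 (divr_ge0 (ler0n R (n * p)) (ltW N0)) c0) e3.
rewrite -[X in X <= _ -> _]mulrA => /le_trans; apply.
by rewrite le_eqVlt; apply/orP; left; apply/eqP; field; exact: lt0r_neq0.
Qed.

End probability.

Lemma square_slack (R : realFieldType) (a h e : R) : 0 <= h -> h <= 1 ->
  h * (2 * a + 1) <= e -> (a + h) ^+ 2 <= a ^+ 2 + e.
Proof. nra. Qed.

Theorem theorem1 (R : realType) (sigma m : R) (sigma_gt0 : 0 < sigma) :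
  exists C2 : R, 0 < C2 /\
  forall (n p N K : nat) (n_gt0 : (0 < n)%N) (p_gt0 : (0 < p)%N)
    (N_gt0 : (0 < N)%N) (K_gt0 : (0 < K)%N)
    (M : 'M[R]_(n, p)) (M_norm : mx_norm M = m)
    (F : set ('rV[R]_K -> R)) (F_L2 : F `<=` @L2_rV R K)
    (M_emb : embeddable F M)
    (C0 : R) (F_approx : approximation_condition F C0)
    (d : measure_display) (Omega : measurableType d) (P : probability Omega R)
    (X : 'I_N -> {RV P >-> borel_mx R n p}) (xi : 'I_N -> {RV P >-> R})
    (X_indep : mutually_independent X)
    (X_unif : forall t A, sampling_matrices A ->
       distribution P (X t) [set A] = ((n * p)%:R^-1)%:E)
    (xi_indep : mutually_independent xi)
    (xi_normal : forall t B, measurable B ->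
       distribution P (xi t) B = normal_prob 0 sigma B)
    (X_xi_indep : independent_families X xi)
    (y : 'I_N -> Omega -> R)
    (y_obs : forall t w, y t w = mxinner (X t w) M + xi t w)
    (N_large : (minn n p)%:R * ln ((n + p)%:R : R) ^+ 2 <= N%:R)
    (lambda : R)
    (lambda_eq : lambda =
       C2 * Num.sqrt (ln (n + p)%:R / (N%:R * (minn n p)%:R)))
    (Mhat : Omega -> 'M[R]_(n, p))
    (Mhat_min : forall w,
       is_estimator lambda (fun t => y t w) (fun t => X t w) (Mhat w)),
  exists E : set Omega,
    [/\ measurable E,
        ((1 - 2 * (n + p)%:R^-1)%:E <= P E)%E &
        forall w, E w -> forall eps : R, 0 < eps ->
          (n * p)%:R^-1 * frobenius_norm (Mhat w - M) ^+ 2 <=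
          C2 ^+ 2 * ((1 + Num.sqrt 2) / 2) ^+ 2
            * ((maxn n p)%:R * ln (n + p)%:R / N%:R)
            * (Jstar F C0 eps)%:R
          + eps ^+ 2].
Proof.
(* adding [1] keeps the bound on the entries positive when [M = 0] *)
pose b : R := `|m| + 1.
have b_gt0 : 0 < b by rewrite ltr_wpDl.
pose C2 : R := 2 * Num.sqrt 3 * (sampling_const b + noise_const sigma).
have B0 : 0 <= @tail_const R by rewrite mulr_ge0 ?expR_ge0.
have kap1 : 0 < sampling_const b.
  by rewrite sqrtr_gt0 mulr_gt0 ?expR_gt0// mulr_gt0// exprn_gt0.
have kap2 : 0 <= noise_const sigma by exact: sqrtr_ge0.
have C2_gt0 : 0 < C2 by rewrite mulr_gt0 ?ltr_pwDl// mulr_gt0// sqrtr_gt0.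
exists C2; split=> // n p N K n_gt0 p_gt0 N_gt0 K_gt0 M M_norm F F_L2 M_emb C0 F_approx
  d Omega P X xi X_indep X_unif xi_indep xi_normal X_xi_indep y y_obs N_large
  lambda lambda_eq Mhat Mhat_min.
have M_le i j : `|M i j| <= b.
  apply: (le_trans (mx_norm_ge M i j)); rewrite M_norm /b.
  by apply: (le_trans (ler_norm m)); rewrite lerDl.
set k := @moment_order R n p.
set s1 := @sampling_level R n p N b; set s2 := @noise_level R n p N sigma.
have s1_gt0 : 0 < s1 := sampling_level_gt0 n_gt0 p_gt0 N_gt0 b_gt0.
have s2_gt0 : 0 < s2 := noise_level_gt0 n_gt0 p_gt0 N_gt0 sigma_gt0.
have k_le := moment_order_le n_gt0 p_gt0 N_large.
have w_ge0 : 0 <= @weight_level R n p N by exact: weight_level_ge0.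
have [mE PE] := good_event_prob n_gt0 p_gt0 N_gt0 sigma_gt0 X_indep X_unif xi_indep
  xi_normal X_xi_indep (ltW b_gt0) M_le k_le
  (exprn_gt0 k.+1.*2 s1_gt0) (exprn_gt0 k.+1.*2 s2_gt0) w_ge0.
exists (good_event X xi M k (s1 ^+ k.+1.*2) (s2 ^+ k.+1.*2)); split=> //.
  rewrite prE// lee_fin; apply: le_trans PE.
  rewrite -!addrA -!opprD lerD2l lerN2 addrA.
  exact: failure_prob_le n_gt0 p_gt0 N_gt0 b_gt0 sigma_gt0 N_large.
move=> w Ew eps eps_gt0.
have np0 : 0 < (n * p)%:R :> R by rewrite ltr0n muln_gt0 n_gt0.
have min0 : 0 < (minn n p)%:R :> R by rewrite ltr0n leq_min n_gt0.
have N0 : 0 < N%:R :> R by rewrite ltr0n.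
have d2 : (2 <= n + p)%N := leq_add n_gt0 p_gt0.
have x0 : 0 < ln (n + p)%:R :> R by rewrite ln_gt0// ltr1n.
have lam0 : 0 < lambda.
  by rewrite lambda_eq mulr_gt0// sqrtr_gt0 divr_gt0// mulr_gt0.
pose mu := lambda * (n * p)%:R.
have mu0 : 0 < mu by rewrite mulr_gt0.
have opb := good_event_opbounded n_gt0 p_gt0 N_gt0 (ltW s1_gt0) (ltW s2_gt0)
  (fun t => y_obs t w) Ew.
have opb2 : opbounded (mu / 2)
    (((n * p)%:R / N%:R) *: (\sum_t y t w *: X t w) - M).
  apply: opbounded_le opb.
    by rewrite mulr_ge0 ?divr_ge0 ?addr_ge0 ?(ltW s1_gt0) ?(ltW s2_gt0).
  have := levels_le b sigma n_gt0 p_gt0 N_gt0; rewrite /mu lambda_eq.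
  by [].

have mini := estimator_minimizer n_gt0 p_gt0 N_gt0 (Mhat_min w).
set J := Jstar F C0 eps.
set S : R := C2 ^+ 2 * _ * _ * J%:R.
have muE : (n * p)%:R^-1 * (mu ^+ 2 * ((1 + Num.sqrt 2) / 2) ^+ 2 * J%:R) = S.
  have -> : (n * p)%:R = (minn n p)%:R * (maxn n p)%:R :> R.
    by rewrite -natrM /minn /maxn; case: ltnP => // _; rewrite mulnC.
  have max0 : 0 < (maxn n p)%:R :> R by rewrite ltr0n leq_max n_gt0.
  rewrite /mu /S exprMn lambda_eq exprMn sqr_sqrtr; last first.
    by rewrite divr_ge0 ?mulr_ge0 ?ltW.
  have -> : (n * p)%:R = (minn n p)%:R * (maxn n p)%:R :> R.
    by rewrite -natrM /minn /maxn; case: ltnP => // _; rewrite mulnC.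
  by field; rewrite !lt0r_neq0.
have bound r : eps < r -> (n * p)%:R^-1 * frobenius_norm (Mhat w - M) ^+ 2 <= S + r ^+ 2.
  move=> epsr; have [A [rA Ar]] := low_rank_approximation M_emb F_approx eps_gt0 epsr.
  have := nuclear_oracle A mu0 mini opb2.
  have : mxinner (A - M) (A - M) <= (n * p)%:R * r ^+ 2.
    apply: mxinner_entries_le; first exact: ltW (lt_trans eps_gt0 epsr).
    by move=> i j; rewrite !mxE.
  have : mu ^+ 2 * ((1 + Num.sqrt 2) / 2) ^+ 2 * (\rank A)%:R <=
      mu ^+ 2 * ((1 + Num.sqrt 2) / 2) ^+ 2 * J%:R.
    apply: ler_wpM2l; last by rewrite ler_nat.
    by apply: mulr_ge0; exact: sqr_ge0.
  rewrite frobenius_normE ler_pdivrMl// -muE mulrDr mulVKf ?gt_eqF//; lra.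
(* let [r] decrease to [eps] *)
apply/ler_addgt0Pr => e e0.
pose r := eps + Num.min 1 (e / (2 * eps + 1)).
have q0 : 0 < 2 * eps + 1 by rewrite addr_gt0// mulr_gt0.
have h0 : 0 < Num.min 1 (e / (2 * eps + 1)) by rewrite lt_min ltr01 divr_gt0.
have := bound r; rewrite /r ltrDl h0 => /(_ isT) H; apply: (le_trans H).
set h := Num.min _ _ in h0 *.
have h1 : h <= 1 by rewrite ge_min lexx.
have h2 : h * (2 * eps + 1) <= e by rewrite -ler_pdivlMr// ge_min lexx orbT.
by rewrite -addrA lerD2l; exact: square_slack (ltW h0) h1 h2.
Qed.
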